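(* Let $n\ge 3$ and let $A,B\subseteq[n]$ be such that $A$ matches $B$ and $A$ is a set of consecutive integers. Let $C=(A\cup B)\setminus(A\cap B)$. Then the elements $\Gamma_A^q,\Gamma_B^q,\Gamma_C^q\in\mathfrak{osp}_q(1|2)^{\otimes n}$ generate a rank 1 $q$-Bannai-Ito algebra, that is, they satisfy \begin{align*} \{\Gamma_A^q,\Gamma_B^q\}_q &= \Gamma_{C}^q + (q^{1/2}+q^{-1/2})\left(\Gamma_{A\cap B}^q\Gamma_{A\cup B}^q + \Gamma_{A\setminus( A\cap B)}^q\Gamma_{B\setminus (A\cap B)}^q\right), \\ \{\Gamma_B^q,\Gamma_C^q\}_q &= \Gamma_{A}^q + (q^{1/2}+q^{-1/2})\left(\Gamma_{B\cap C}^q\Gamma_{B\cup C}^q + \Gamma_{B\setminus (B\cap C)}^q\Gamma_{C\setminus (B\cap C)}^q\right), \\ \{\Gamma_C^q,\Gamma_A^q\}_q &= \Gamma_{B}^q + (q^{1/2}+q^{-1/2})\left(\Gamma_{C\cap A}^q\Gamma_{C\cup A}^q + \Gamma_{C\setminus (C\cap A)}^q\Gamma_{A\setminus (C\cap A)}^q\right). \end{align*}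
   Context: Let $q$ be a nonzero complex number with $|q|\neq1$ and a fixed square root $q^{1/2}$. Notation: $[a]_q=\frac{q^a-q^{-a}}{q-q^{-1}}$, $\{X,Y\}_q=q^{1/2}XY+q^{-1/2}YX$, $\{X,Y\}=XY+YX$, $[n]=\{1,\dots,n\}$, $[i;j]=\{i,i+1,\dots,j\}$. **Matching.** $A$ matches $B$ if $\max(A\setminus(A\cap B))<\min(A\cap B)$ and $\max(A\cap B)<\min(B\setminus(A\cap B))$ (in particular the three sets $A\setminus(A\cap B)$, $A\cap B$, $B\setminus(A\cap B)$ are nonempty). **The algebra.** $\mathfrak{osp}_q(1|2)$ is the unital associative $\mathbb C$-algebra with generators $A_+,A_-,K,K^{-1},P$ and relations $KA_{\pm}K^{-1}=q^{\pm1/2}A_\pm$, $\{A_+,A_-\}=\frac{K^2-K^{-2}}{q^{1/2}-q^{-1/2}}$, $\{P,A_\pm\}=0$, $[P,K]=[P,K^{-1}]=0$, $KK^{-1}=K^{-1}K=1$, $P^2=1$. Tensor powers carry the standard (ungraded) product $(a_1\otimes\dots\otimes a_n)(b_1\otimes\dots\otimes b_n)=a_1b_1\otimes\dots\otimes a_nb_n$. The coproduct is the algebra morphism $\Delta$ with $\Delta(A_\pm)=A_\pm\otimes KP+K^{-1}\otimes A_\pm$, $\Delta(K)=K\otimes K$, $\Delta(P)=P\otimes P$. The Casimir element is $\Gamma^q=\left(-A_+A_-+\frac{q^{-1/2}K^2-q^{1/2}K^{-2}}{q-q^{-1}}\right)P$, which is central. **The coaction.** $\mathcal I$ is the subalgebra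 of $\mathfrak{osp}_q(1|2)$ generated by $A_-K,A_+K,K^2P,\Gamma^q$, and $\tau:\mathcal I\to\mathfrak{osp}_q(1|2)\otimes\mathcal I$ is the algebra morphism with \begin{align*} \tau(A_-K)&=K^2P\otimes A_-K,\\ \tau(A_+K)&=K^{-2}P\otimes A_+K+q^{-1/2}(q-q^{-1})A_+^2P\otimes A_-K+q^{-1/2}(q^{1/2}-q^{-1/2})A_+K^{-1}P\otimes K^2P\\&\quad+q^{-1/2}(q-q^{-1})A_+K^{-1}P\otimes\Gamma^q,\\ \tau(K^2P)&=1\otimes K^2P-(q-q^{-1})A_+K\otimes A_-K,\qquad \tau(\Gamma^q)=1\otimes\Gamma^q. \end{align*} **The elements $\Gamma_A^q$.** Put $\Gamma_\emptyset^q=-[\tfrac12]_q$. For nonempty $A\subseteq[n]$ with $a=\min A$, $b=\max A$, $$\Gamma_A^q=1^{\otimes(a-1)}\otimes\left(\tau^A_{b-1,b}\cdots\tau^A_{a+1,a+2}\,\tau^A_{a,a+1}\right)(\Gamma^q)\otimes1^{\otimes(n-b)},$$ (the map $\tau^A_{a,a+1}$ is applied first; if $a=b$ no map is applied), where, writing $1$ also for identity maps, - $\tau^A_{k-1,k}=1^{\otimes(k-a-1)}\otimes\Delta$ if $k-1\in A$, $k\in A$; - $\tau^A_{k-1,k}=(1^{\otimes(k-a)}\otimes\tau)(1^{\otimes(k-a-1)}\otimes\Delta)$ if $k-1\in A$, $k\notin A$; - $\tau^A_{k-1,k}=1^{\otimes(k-a-1)}\otimes\Delta\otimes1$ if $k-1\notin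 A$, $k\notin A$; - $\tau^A_{k-1,k}=\mathrm{id}$ if $k-1\notin A$, $k\in A$. (The last tensor factors of the elements to which $\tau$ is applied lie in $\mathcal I$.) *)

(* Defs.v *)
(* MathComp, with the classical axioms and realType of MathComp-Analysis. *)
From HB Require Import structures.
From mathcomp Require Import all_boot all_order all_algebra.
From mathcomp Require Import generic_quotient ssrAC.
From mathcomp Require Import boolp classical_sets reals.
From mathcomp.real_closed Require Import complex.

Set Implicit Arguments.
Unset Strict Implicit.
Unset Printing Implicit Defensive.

Import Order.TTheory GRing.Theory Num.Theory.
Local Open Scope ring_scope.
Local Open Scope quotient_scope.

Lemma submod_projection (F : fieldType) (V : lmodType F) (S : {pred V}) :
  submod_closed S ->
  exists p : V -> V, [/\ linear p, forall x, p x \in S & {in S, p =1 id}].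
Proof.
move=> Ssub; have [S0 Slin] := Ssub.
have SZ c x : x \in S -> c *: x \in S.
  by move=> Sx; rewrite -[_ *: _]addr0; exact: Slin.
have SD x y : x \in S -> y \in S -> x + y \in S.
  by move=> Sx Sy; rewrite -[x]scale1r; exact: Slin.
pose P (W : set V) := (forall c x y, W x -> W y -> W (c *: x + y)) /\
                      (forall x, W x -> x \in S -> x = 0).
have [|W [[Wlin WS] Wmax]] := @Zorn_bigcup V P.
  move=> FF FP Ftot; split=> [c x y [X FX Xx] [Y FY Yy]|x [X FX Xx] Sx].
    have [XY|YX] := Ftot _ _ FX FY.
      by exists Y => //; apply: (FP _ FY).1 => //; exact: XY.
    by exists X => //; apply: (FP _ FX).1 => //; exact: YX.
  exact: (FP _ FX).2.
have W0 : W 0.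
  apply: contrapT => nW0; apply: (Wmax [set 0]%classic); last first.
    by split=> [c x y /= -> ->|x /= -> //]; rewrite scaler0 addr0.
  split=> [w Ww|H0]; last by apply: nW0; exact: H0.
  by exfalso; apply: nW0; have := Wlin (-1) w w Ww Ww; rewrite scaleN1r addNr.
have WZ c x : W x -> W (c *: x).
  by move=> Wx; rewrite -[_ *: _]addr0; exact: Wlin.
have WD x y : W x -> W y -> W (x + y).
  by move=> Wx Wy; rewrite -[x]scale1r; exact: Wlin.
have full u : exists x, x \in S /\ W (u - x).
  apply: contrapT => nu.
  pose W' := [set x | exists w c, W w /\ x = w + c *: u]%classic.
  apply: (Wmax W').
    split=> [w Ww|W'W]; first by exists w, 0; rewrite scale0r addr0.
    apply: nu; exists 0; rewrite subr0; split=> //.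
    by apply: W'W; exists 0, 1; rewrite add0r scale1r.
  split=> [c _ _ [w [d [Ww ->]]] [w' [d' [Ww' ->]]]|_ [w [d [Ww ->]]] Swd].
    exists (c *: w + w'), (c * d + d'); split; first exact: Wlin.
    by rewrite scalerDr scalerDl scalerA addrACA.
  have [d0|d0] := eqVneq d 0.
    by move: Swd; rewrite d0 scale0r addr0; exact: WS.
  exfalso; apply: nu; exists (d^-1 *: (w + d *: u)); split; first exact: SZ.
  rewrite scalerDr scalerA mulVf // scale1r opprD addrCA subrr addr0.
  by rewrite -scaleN1r scalerA; exact: WZ.
have uniq u x y : x \in S -> y \in S -> W (u - x) -> W (u - y) -> x = y.
  move=> Sx Sy Wx Wy; apply/eqP; rewrite -subr_eq0; apply/eqP/WS.
    have := Wlin (-1) _ _ Wx Wy.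
    by rewrite scaleN1r opprB addrA subrK.
  by rewrite addrC -scaleN1r; exact: Slin.
pose p u := projT1 (cid (full u)).
have pS u : p u \in S by rewrite /p; case: cid => x [].
have pW u : W (u - p u) by rewrite /p; case: cid => x [].
exists p; split=> // [c x y|x Sx]; last first.
  by apply: (uniq x) => //; rewrite subrr.
apply: (uniq (c *: x + y)) => //; first exact: Slin.
by rewrite opprD addrACA -scalerBr; exact: Wlin.
Qed.

Section Tensor.
Variables (F : fieldType) (A B : algType F).

(* A list of pairs stands for the sum of the corresponding pure tensors; the
   relation is the congruence defining the tensor product over F. *)
Inductive tensor_eq : seq (A * B) -> seq (A * B) -> Prop :=
| teq_refl s : tensor_eq s s
| teq_sym s t : tensor_eq s t -> tensor_eq t s
| teq_trans s t u : tensor_eq s t -> tensor_eq t u -> tensor_eq s u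
| teq_cat s s' t t' :
    tensor_eq s s' -> tensor_eq t t' -> tensor_eq (s ++ t) (s' ++ t')
| teq_catC s t : tensor_eq (s ++ t) (t ++ s)
| teq_0 b : tensor_eq [:: (0, b)] [::]
| teq_Dl a a' b : tensor_eq [:: (a + a', b)] [:: (a, b); (a', b)]
| teq_Dr a b b' : tensor_eq [:: (a, b + b')] [:: (a, b); (a, b')]
| teq_Z c a b : tensor_eq [:: (c *: a, b)] [:: (a, c *: b)].

Lemma teqb_equiv : equiv_class_of (fun s t => `[< tensor_eq s t >]).
Proof.
split=> [s|s t|t s u]; first by apply/asboolP; exact: teq_refl.
  by apply/asboolP/asboolP; exact: teq_sym.
by move=> /asboolP st /asboolP tu; apply/asboolP; exact: teq_trans st tu.
Qed.

Canonical teqb := EquivRelPack teqb_equiv.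

Definition tensor := {eq_quot teqb}.
HB.instance Definition _ := Choice.on tensor.
HB.instance Definition _ := EqQuotient.on tensor.

Lemma teqP s t : \pi_tensor s = \pi_tensor t <-> tensor_eq s t.
Proof. by split=> [/eqmodP/asboolP//|st]; apply/eqmodP/asboolP. Qed.

Lemma repr_teq s : tensor_eq (repr (\pi_tensor s)) s.
Proof. by apply/teqP; rewrite reprK. Qed.

Definition pure (a : A) (b : B) : tensor := \pi_tensor [:: (a, b)].

Definition tadd (x y : tensor) : tensor := \pi_tensor (repr x ++ repr y).
Definition tscale (c : F) (x : tensor) : tensor :=
  \pi_tensor [seq (c *: p.1, p.2) | p <- repr x].

Lemma taddE s t : tadd (\pi_tensor s) (\pi_tensor t) = \pi_tensor (s ++ t).
Proof. by apply/teqP; apply: teq_cat; exact: repr_teq. Qed.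

Lemma teq_scale c s t : tensor_eq s t ->
  tensor_eq [seq (c *: p.1, p.2) | p <- s] [seq (c *: p.1, p.2) | p <- t].
Proof.
elim=> /= {s t} [s|s t _|s t u _ st _ tu|s s' t t' _ ss _ tt|s t|b|a a' b|a b b'|d a b].
- exact: teq_refl.
- exact: teq_sym.
- exact: teq_trans st tu.
- by rewrite !map_cat; exact: teq_cat.
- by rewrite !map_cat; exact: teq_catC.
- by rewrite scaler0; exact: teq_0.
- by rewrite scalerDr; exact: teq_Dl.
- exact: teq_Dr.
- by rewrite scalerA mulrC -scalerA; exact: teq_Z.
Qed.

Lemma tscaleE c s :
  tscale c (\pi_tensor s) = \pi_tensor [seq (c *: p.1, p.2) | p <- s].
Proof. by apply/teqP; apply: teq_scale; exact: repr_teq. Qed.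

Lemma tensor_quotW (P : tensor -> Prop) :
  (forall s, P (\pi_tensor s)) -> forall x, P x.
Proof. by move=> H x; rewrite -[x]reprK; exact: H. Qed.

Lemma taddA : associative tadd.
Proof.
elim/tensor_quotW=> s; elim/tensor_quotW=> t; elim/tensor_quotW=> u.
by rewrite !taddE catA.
Qed.

Lemma taddC : commutative tadd.
Proof.
elim/tensor_quotW=> s; elim/tensor_quotW=> t.
by rewrite !taddE; apply/teqP; exact: teq_catC.
Qed.

Lemma tadd0 : left_id (\pi_tensor [::]) tadd.
Proof. by elim/tensor_quotW=> s; rewrite taddE. Qed.

Lemma teq_cons p s t : tensor_eq s t -> tensor_eq (p :: s) (p :: t).
Proof. by move=> st; apply: (@teq_cat [:: p] [:: p]) => //; exact: teq_refl. Qed.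

Lemma tscaleDl x : {morph tscale^~ x : a b / a + b >-> tadd a b}.
Proof.
move=> c d; elim/tensor_quotW: x => s; rewrite !tscaleE taddE; apply/teqP.
elim: s => [|p s IH] /=; first exact: teq_refl.
rewrite scalerDl; apply: (teq_trans (teq_cat (teq_Dl _ _ _) IH)) => /=.
apply: teq_cons; rewrite -cat1s catA.
rewrite -[X in tensor_eq _ (_ ++ X)]cat1s catA.
by apply: teq_cat; [exact: teq_catC|exact: teq_refl].
Qed.

Lemma tscale0 x : tscale 0 x = \pi_tensor [::].
Proof.
elim/tensor_quotW: x => s; rewrite !tscaleE; apply/teqP.
elim: s => [|p s IH] /=; first exact: teq_refl.
by rewrite scale0r; exact: (teq_cat (teq_0 _) IH).
Qed.

Lemma tscaleA c d x : tscale c (tscale d x) = tscale (c * d) x.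
Proof.
elim/tensor_quotW: x => s; rewrite !tscaleE -map_comp; congr (\pi_tensor _).
by apply: eq_map => p /=; rewrite scalerA.
Qed.

Lemma tscale1 : left_id 1 tscale.
Proof.
elim/tensor_quotW => s; rewrite tscaleE; congr (\pi_tensor _).
by rewrite -[RHS]map_id; apply: eq_map => -[a b] /=; rewrite scale1r.
Qed.

Lemma tscaleDr : right_distributive tscale tadd.
Proof.
move=> c; elim/tensor_quotW=> s; elim/tensor_quotW=> t.
by rewrite taddE !tscaleE taddE map_cat.
Qed.

Lemma taddN : left_inverse (\pi_tensor [::]) (tscale (-1)) tadd.
Proof. by move=> x; rewrite -{2}[x]tscale1 -tscaleDl addNr tscale0. Qed.

HB.instance Definition _ := GRing.isZmodule.Build tensor taddA taddC tadd0 taddN.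
HB.instance Definition _ :=
  GRing.Zmodule_isLmodule.Build F tensor tscaleA tscale1 tscaleDr tscaleDl.

Lemma tensorE (s : seq (A * B)) : \pi_tensor s = \sum_(p <- s) pure p.1 p.2.
Proof.
elim: s => [|[a b] s IH]; first by rewrite big_nil.
by rewrite big_cons -IH -[in LHS]cat1s -taddE.
Qed.

Lemma pureDl b : {morph pure^~ b : a a' / a + a'}.
Proof. by move=> a a'; rewrite [RHS]taddE; apply/teqP; exact: teq_Dl. Qed.

Lemma pureDr a : {morph pure a : b b' / b + b'}.
Proof. by move=> b b'; rewrite [RHS]taddE; apply/teqP; exact: teq_Dr. Qed.

Lemma pureZl c a b : pure (c *: a) b = c *: pure a b.
Proof. by rewrite [RHS]tscaleE. Qed.

Lemma pureZr c a b : pure a (c *: b) = c *: pure a b.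
Proof. by rewrite -pureZl; apply/teqP; apply/teq_sym; exact: teq_Z. Qed.

Lemma pure_linl b : linear (pure^~ b).
Proof. by move=> c x y; rewrite pureDl pureZl. Qed.
Lemma pure_linr a : linear (pure a).
Proof. by move=> c x y; rewrite pureDr pureZr. Qed.

Lemma tensor_ind (P : tensor -> Prop) :
  P 0 -> (forall a b x, P x -> P (pure a b + x)) -> forall x, P x.
Proof.
move=> P0 PD; elim/tensor_quotW=> s; rewrite tensorE.
by elim: s => [|p s IH]; rewrite ?big_nil// big_cons; exact: PD.
Qed.

Definition bilin (V : lmodType F) (f : A -> B -> V) :=
  (forall b, linear (f^~ b)) /\ (forall a, linear (f a)).

Definition tlift (V : lmodType F) (f : A -> B -> V) (x : tensor) : V :=
  \sum_(p <- repr x) f p.1 p.2.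

Section Lift.
Variables (V : lmodType F) (f : A -> B -> V).
Hypothesis fbil : bilin f.

Let fDl b : {morph f^~ b : a a' / a + a'}.
Proof. by move=> a a'; have := fbil.1 b 1 a a'; rewrite !scale1r. Qed.
Let fDr a : {morph f a : b b' / b + b'}.
Proof. by move=> b b'; have := fbil.2 a 1 b b'; rewrite !scale1r. Qed.
Let f0l b : f 0 b = 0.
Proof. by apply: (addrI (f 0 b)); rewrite -fDl !addr0. Qed.
Let f0r a : f a 0 = 0.
Proof. by apply: (addrI (f a 0)); rewrite -fDr !addr0. Qed.
Let fZl c a b : f (c *: a) b = c *: f a b.
Proof. by have := fbil.1 b c a 0; rewrite !addr0 f0l addr0. Qed.
Let fZr c a b : f a (c *: b) = c *: f a b.
Proof. by have := fbil.2 a c b 0; rewrite !addr0 f0r addr0. Qed.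

Lemma tlift_pi s : tlift f (\pi_tensor s) = \sum_(p <- s) f p.1 p.2.
Proof.
rewrite /tlift; move: (repr_teq s); move: (repr _) => t.
elim=> {s t} [//|//|s t u _ -> _ ->//|s s' t t' _ ss _ tt|s t|b|a a' b|a b b'|c a b].
- by rewrite !big_cat /= ss tt.
- by rewrite !big_cat /= addrC.
- by rewrite big_seq1 big_nil f0l.
- by rewrite big_seq1 big_cons big_seq1 fDl.
- by rewrite big_seq1 big_cons big_seq1 fDr.
- by rewrite !big_seq1 /= fZl fZr.
Qed.

Lemma tlift_pure a b : tlift f (pure a b) = f a b.
Proof. by rewrite tlift_pi big_seq1. Qed.

Lemma tlift_linear : linear (tlift f).
Proof.
move=> c; elim/tensor_quotW=> s; elim/tensor_quotW=> t.
rewrite [_ *: _]tscaleE [_ + _]taddE !tlift_pi big_cat /= big_map scaler_sumr.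
by congr (_ + _); apply: eq_bigr => p _; exact: fZl.
Qed.
End Lift.

Definition tmul (x y : tensor) : tensor :=
  tlift (fun a b => tlift (fun a' b' => pure (a * a') (b * b')) y) x.

Lemma tmul_bilin1 a b : bilin (fun a' b' => pure (a * a') (b * b')).
Proof.
split=> [b' c x y|a' c x y].
  by rewrite mulrDr -scalerAr pure_linl.
by rewrite mulrDr -scalerAr pure_linr.
Qed.

Lemma tmul_bilin2 y :
  bilin (fun a b => tlift (fun a' b' => pure (a * a') (b * b')) y).
Proof.
split=> [b c x z|a c x z]; rewrite /tlift scaler_sumr -big_split;
  apply: eq_bigr => p _ /=; rewrite mulrDl -scalerAl.
  exact: pure_linl.
exact: pure_linr.
Qed.

Lemma tmul_pure a b a' b' :
  tmul (pure a b) (pure a' b') = pure (a * a') (b * b').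
Proof.
by rewrite /tmul tlift_pure ?tlift_pure //; [exact: tmul_bilin1|exact: tmul_bilin2].
Qed.

Lemma tmul_linl y : linear (tmul^~ y).
Proof. exact: tlift_linear (tmul_bilin2 y). Qed.

Lemma tmul_linr x : linear (tmul x).
Proof.
move=> c y z; have E f : tlift f x = \sum_(p <- repr x) f p.1 p.2 by [].
rewrite /tmul !E scaler_sumr -big_split; apply: eq_bigr => p _.
exact: tlift_linear (tmul_bilin1 _ _) _ _ _.
Qed.

Lemma tmulDl : left_distributive tmul +%R.
Proof. by move=> x y z; have := tmul_linl z 1 x y; rewrite !scale1r. Qed.
Lemma tmulDr : right_distributive tmul +%R.
Proof. by move=> x y z; have := tmul_linr x 1 y z; rewrite !scale1r. Qed.
Lemma tmul0l x : tmul 0 x = 0.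
Proof. by apply: (addrI (tmul 0 x)); rewrite -tmulDl !addr0. Qed.
Lemma tmul0r x : tmul x 0 = 0.
Proof. by apply: (addrI (tmul x 0)); rewrite -tmulDr !addr0. Qed.

Lemma tmulA : associative tmul.
Proof.
move=> x y z; elim/tensor_ind: x => [|a b x IHx]; first by rewrite !tmul0l.
rewrite !tmulDl IHx; congr (_ + _) => {x IHx}.
elim/tensor_ind: y => [|a' b' y IHy]; first by rewrite !(tmul0l,tmul0r).
rewrite tmulDl !tmulDr tmulDl IHy; congr (_ + _) => {y IHy}.
elim/tensor_ind: z => [|a2 b2 z IHz]; first by rewrite !(tmul0l,tmul0r).
by rewrite !tmulDr IHz !tmul_pure !mulrA.
Qed.

Lemma tmul1l : left_id (pure 1 1) tmul.
Proof.
elim/tensor_ind=> [|a b x IH]; first by rewrite tmul0r.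
by rewrite tmulDr IH tmul_pure !mul1r.
Qed.
Lemma tmul1r : right_id (pure 1 1) tmul.
Proof.
elim/tensor_ind=> [|a b x IH]; first by rewrite tmul0l.
by rewrite tmulDl IH tmul_pure !mulr1.
Qed.

End Tensor.

Lemma unit_functional (F : fieldType) (A : algType F) :
  exists p : A -> F^o, linear p /\ p 1 = 1.
Proof.
pose S : {pred A} := fun x => `[< exists c : F, x = c%:A >].
have Sc : submod_closed S.
  split=> [|c x y]; first by apply/asboolP; exists 0; rewrite scale0r.
  move=> /asboolP[d ->] /asboolP[e ->]; apply/asboolP.
  by exists (c * d + e); rewrite scalerDl scalerA.
have [p [plin pS pid]] := submod_projection Sc.
have pE x : exists c : F, p x = c%:A by apply/asboolP; exact: pS.
have inj (c d : F) : c%:A = d%:A :> A -> c = d.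
  move/eqP; rewrite -subr_eq0 -scalerBl scaler_eq0 oner_eq0 orbF subr_eq0.
  by move/eqP.
exists (fun x => projT1 (cid (pE x))); split=> [c x y|].
  case: cid => d; case: cid => e /= pe; case: cid => f /= pf.
  by rewrite plin pe pf scalerA -scalerDl => /inj.
case: cid => c /= pc; apply: inj; rewrite -pc scale1r pid//.
by apply/asboolP; exists 1; rewrite scale1r.
Qed.

Section TensorAlgebra.
Variables (F : fieldType) (A B : algType F).

Lemma tone_neq0 : pure (1 : A) (1 : B) != 0.
Proof.
have [p [plin p1]] := unit_functional A.
have [r [rlin r1]] := unit_functional B.
pose f (a : A) (b : B) : F^o := p a * r b.
have fb : bilin f.
  split=> [b c x y|a c x y]; rewrite /f ?plin ?rlin.
    by rewrite mulrDl -scalerAl.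
  by rewrite mulrDr -scalerAr.
apply/eqP => /(congr1 (tlift f)); rewrite tlift_pure //.
have -> : tlift f 0 = 0 by rewrite [LHS](tlift_pi fb) big_nil.
by rewrite /f p1 r1 mulr1 => /eqP; rewrite oner_eq0.
Qed.

HB.instance Definition _ := GRing.Zmodule_isNzRing.Build (tensor A B)
  (@tmulA F A B) (@tmul1l F A B) (@tmul1r F A B)
  (@tmulDl F A B) (@tmulDr F A B) tone_neq0.

Lemma tscaleAl (c : F) (x y : tensor A B) : c *: (x * y) = (c *: x) * y.
Proof. by have := tmul_linl y c x 0; rewrite !addr0 tmul0l addr0. Qed.
HB.instance Definition _ :=
  GRing.Lmodule_isLalgebra.Build F (tensor A B) tscaleAl.
Lemma tscaleAr (c : F) (x y : tensor A B) : c *: (x * y) = x * (c *: y).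
Proof. by have := tmul_linr x c y 0; rewrite !addr0 tmul0r addr0. Qed.
HB.instance Definition _ :=
  GRing.Lalgebra_isAlgebra.Build F (tensor A B) tscaleAr.
End TensorAlgebra.

Local Notation "a ⊗ b" := (pure a b) (at level 40).

Section TensorMaps.
Variables (F : fieldType) (A B C A' B' : algType F).

Section Map.
Variables (f : {linear A -> A'}) (g : {linear B -> B'}).

Definition tmap : tensor A B -> tensor A' B' := tlift (fun a b => pure (f a) (g b)).

Lemma tmap_bilin : bilin (fun a b => pure (f a) (g b)).
Proof. by split=> [b c x y|a c x y]; rewrite linearP ?pure_linl ?pure_linr. Qed.

Lemma tmap_linear : linear tmap.
Proof. exact: tlift_linear tmap_bilin. Qed.
HB.instance Definition _ :=
  GRing.isLinear.Build F (tensor A B) (tensor A' B') _ tmap tmap_linear.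

Lemma tmap_pure a b : tmap (pure a b) = pure (f a) (g b).
Proof. exact: tlift_pure tmap_bilin _ _. Qed.
End Map.

Definition tassoc : tensor A (tensor B C) -> tensor (tensor A B) C :=
  tlift (fun a => tlift (fun b c => pure (pure a b) c)).

Lemma tassoc_bilin1 a : bilin (fun (b : B) (c : C) => pure (pure (a : A) b) c).
Proof. by split=> [c d x y|b d x y]; rewrite ?pure_linr ?pure_linl ?pure_linr. Qed.

Lemma tassoc_bilin :
  bilin (fun a : A => tlift (fun (b : B) (c : C) => pure (pure a b) c)).
Proof.
split=> [x d a a'|a]; last exact: tlift_linear (tassoc_bilin1 a).
rewrite /tlift scaler_sumr -big_split; apply: eq_bigr => p _ /=.
by rewrite !pure_linl.
Qed.

Lemma tassoc_linear : linear tassoc.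
Proof. exact: tlift_linear tassoc_bilin. Qed.
HB.instance Definition _ :=
  GRing.isLinear.Build F (tensor A (tensor B C)) (tensor (tensor A B) C) _
    tassoc tassoc_linear.

Lemma tassoc_pure a b c : tassoc (pure a (pure b c)) = pure (pure a b) c.
Proof.
by rewrite /tassoc (tlift_pure tassoc_bilin) (tlift_pure (tassoc_bilin1 a)).
Qed.
End TensorMaps.
Arguments tassoc {F A B C}.

Section GeneratedSubalgebra.
Variables (F : fieldType) (A : algType F) (S : A -> Prop).

Definition gen_subalg : {pred A} := fun x =>
  `[< forall D : {pred A}, subalg_closed D -> (forall y, S y -> y \in D) ->
      x \in D >].

Lemma gen_subalgP x : reflect (forall D : {pred A},
  subalg_closed D -> (forall y, S y -> y \in D) -> x \in D) (x \in gen_subalg).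
Proof. exact: asboolP. Qed.

Lemma mem_gen_subalg x : S x -> x \in gen_subalg.
Proof. by move=> Sx; apply/gen_subalgP => D _; exact. Qed.

Lemma gen_subalg_closed : subalg_closed gen_subalg.
Proof.
split=> [|c x y|x y].
- by apply/gen_subalgP => D [].
- move=> /gen_subalgP xI /gen_subalgP yI; apply/gen_subalgP => D Dsub SD.
  by have [_ Dlin _] := Dsub; apply: Dlin; [exact: xI|exact: yI].
- move=> /gen_subalgP xI /gen_subalgP yI; apply/gen_subalgP => D Dsub SD.
  by have [_ _ DM] := Dsub; apply: DM; [exact: xI|exact: yI].
Qed.

Definition subalg := {x : A | x \in gen_subalg}.
HB.instance Definition _ := [isSub of subalg for @sval A (fun x => x \in gen_subalg)].
HB.instance Definition _ := [Choice of subalg by <:].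
HB.instance Definition _ :=
  GRing.SubChoice_isSubAlgebra.Build F A gen_subalg subalg
    (GRing.subalg_closed_semi gen_subalg_closed).

Lemma subalg_proj_exists :
  exists p : A -> subalg, linear p /\ forall x : subalg, p (val x) = x.
Proof.
have [p [plin pS pid]] :=
  submod_projection (GRing.subalg_closedZ gen_subalg_closed).
exists (fun x => Sub (p x) (pS x)); split=> [c x y|x]; apply/val_inj => /=.
  by rewrite plin.
by rewrite pid //; exact: valP.
Qed.

(* Some linear retraction of A onto the subalgebra, used only to regard an
   element of V (x) A lying in V (x) subalg as an element of the latter; on such
   elements the choice of the retraction is irrelevant. *)
Definition subalg_proj : A -> subalg := projT1 (cid subalg_proj_exists).
Lemma subalg_proj_linear : linear subalg_proj.
Proof. by rewrite /subalg_proj; case: cid => p []. Qed.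
HB.instance Definition _ :=
  GRing.isLinear.Build F A subalg _ subalg_proj subalg_proj_linear.
Lemma subalg_projK (x : subalg) : subalg_proj (val x) = x.
Proof. by rewrite /subalg_proj; case: cid => p []. Qed.

End GeneratedSubalgebra.

Variant osp_gen := GAp | GAm | GK | GKi | GP.

(* The parameter s is the chosen square root of q, so that q is s ^+ 2. *)
Section Osp.
Variables (F : fieldType) (s : F).
Local Notation q := (s ^+ 2).

Inductive osp_term :=
| Gen of osp_gen
| Cst of F
| Add of osp_term & osp_term
| Mul of osp_term & osp_term.

Declare Scope osp_term_scope.
Delimit Scope osp_term_scope with t.
Local Notation "t + u" := (Add t u) : osp_term_scope.
Local Notation "t * u" := (Mul t u) : osp_term_scope.
Local Notation "t - u" := (Add t (Mul (Cst (-1)) u)) : osp_term_scope.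

Local Notation Ap' := (Gen GAp).
Local Notation Am' := (Gen GAm).
Local Notation K' := (Gen GK).
Local Notation Ki' := (Gen GKi).
Local Notation P' := (Gen GP).

Inductive osp_rel : osp_term -> osp_term -> Prop :=
| osp_KAp : osp_rel (K' * Ap' * Ki')%t (Cst s * Ap')%t
| osp_KAm : osp_rel (K' * Am' * Ki')%t (Cst s^-1 * Am')%t
| osp_ApAm : osp_rel (Ap' * Am' + Am' * Ap')%t
    (Cst (s - s^-1)^-1 * (K' * K' - Ki' * Ki'))%t
| osp_PAp : osp_rel (P' * Ap' + Ap' * P')%t (Cst 0)
| osp_PAm : osp_rel (P' * Am' + Am' * P')%t (Cst 0)
| osp_PK : osp_rel (P' * K' - K' * P')%t (Cst 0)
| osp_PKi : osp_rel (P' * Ki' - Ki' * P')%t (Cst 0)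
| osp_KKi : osp_rel (K' * Ki')%t (Cst 1)
| osp_KiK : osp_rel (Ki' * K')%t (Cst 1)
| osp_PP : osp_rel (P' * P')%t (Cst 1).

(* The congruence of unital associative F-algebras generated by osp_rel; scaling
   by c is multiplication by Cst c. *)
Inductive osp_eq : osp_term -> osp_term -> Prop :=
| oeq_rel t u : osp_rel t u -> osp_eq t u
| oeq_refl t : osp_eq t t
| oeq_sym t u : osp_eq t u -> osp_eq u t
| oeq_trans t u v : osp_eq t u -> osp_eq u v -> osp_eq t v
| oeq_add t t' u u' : osp_eq t t' -> osp_eq u u' -> osp_eq (t + u)%t (t' + u')%t
| oeq_mul t t' u u' : osp_eq t t' -> osp_eq u u' -> osp_eq (t * u)%t (t' * u')%t
| oeq_addA t u v : osp_eq (t + (u + v))%t (t + u + v)%t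
| oeq_addC t u : osp_eq (t + u)%t (u + t)%t
| oeq_add0 t : osp_eq (Cst 0 + t)%t t
| oeq_mulA t u v : osp_eq (t * (u * v))%t (t * u * v)%t
| oeq_mul1 t : osp_eq (Cst 1 * t)%t t
| oeq_mul0 t : osp_eq (Cst 0 * t)%t (Cst 0)
| oeq_mulDl t u v : osp_eq ((t + u) * v)%t (t * v + u * v)%t
| oeq_mulDr t u v : osp_eq (t * (u + v))%t (t * u + t * v)%t
| oeq_cstD c d : osp_eq (Cst (c + d)) (Cst c + Cst d)%t
| oeq_cstM c d : osp_eq (Cst (c * d)) (Cst c * Cst d)%t
| oeq_cstC c t : osp_eq (Cst c * t)%t (t * Cst c)%t.

HB.instance Definition _ := gen_eqMixin osp_term.
HB.instance Definition _ := gen_choiceMixin osp_term.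

Lemma oeqb_equiv : equiv_class_of (fun t u => `[< osp_eq t u >]).
Proof.
split=> [t|t u|t u v]; first by apply/asboolP; exact: oeq_refl.
  by apply/asboolP/asboolP; exact: oeq_sym.
by move=> /asboolP tu /asboolP uv; apply/asboolP; exact: oeq_trans tu uv.
Qed.
Canonical oeqb := EquivRelPack oeqb_equiv.

Definition osp := {eq_quot oeqb}.
HB.instance Definition _ := Choice.on osp.
HB.instance Definition _ := EqQuotient.on osp.

Lemma oeqP t u : \pi_osp t = \pi_osp u <-> osp_eq t u.
Proof. by split=> [/eqmodP/asboolP//|tu]; apply/eqmodP/asboolP. Qed.

Lemma repr_oeq t : osp_eq (repr (\pi_osp t)) t.
Proof. by apply/oeqP; rewrite reprK. Qed.

Definition oadd (x y : osp) : osp := \pi_osp (repr x + repr y)%t.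
Definition omul (x y : osp) : osp := \pi_osp (repr x * repr y)%t.
Definition ocst (c : F) : osp := \pi_osp (Cst c).

Lemma oaddE t u : oadd (\pi_osp t) (\pi_osp u) = \pi_osp (t + u)%t.
Proof. by apply/oeqP; apply: oeq_add; exact: repr_oeq. Qed.
Lemma omulE t u : omul (\pi_osp t) (\pi_osp u) = \pi_osp (t * u)%t.
Proof. by apply/oeqP; apply: oeq_mul; exact: repr_oeq. Qed.

Lemma osp_quotW (P : osp -> Prop) : (forall t, P (\pi_osp t)) -> forall x, P x.
Proof. by move=> H x; rewrite -[x]reprK; exact: H. Qed.

Lemma oaddA : associative oadd.
Proof.
elim/osp_quotW=> t; elim/osp_quotW=> u; elim/osp_quotW=> v.
by rewrite !oaddE; apply/oeqP; exact: oeq_addA.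
Qed.
Lemma oaddC : commutative oadd.
Proof.
elim/osp_quotW=> t; elim/osp_quotW=> u.
by rewrite !oaddE; apply/oeqP; exact: oeq_addC.
Qed.
Lemma oadd0 : left_id (ocst 0) oadd.
Proof. by elim/osp_quotW=> t; rewrite oaddE; apply/oeqP; exact: oeq_add0. Qed.
Lemma omulA : associative omul.
Proof.
elim/osp_quotW=> t; elim/osp_quotW=> u; elim/osp_quotW=> v.
by rewrite !omulE; apply/oeqP; exact: oeq_mulA.
Qed.
Lemma omul1l : left_id (ocst 1) omul.
Proof. by elim/osp_quotW=> t; rewrite omulE; apply/oeqP; exact: oeq_mul1. Qed.
Lemma ocstC c x : omul (ocst c) x = omul x (ocst c).
Proof.
by elim/osp_quotW: x => t; rewrite !omulE; apply/oeqP; exact: oeq_cstC.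
Qed.
Lemma omul1r : right_id (ocst 1) omul.
Proof. by move=> x; rewrite -ocstC omul1l. Qed.
Lemma omulDl : left_distributive omul oadd.
Proof.
elim/osp_quotW=> t; elim/osp_quotW=> u; elim/osp_quotW=> v.
by rewrite !(oaddE, omulE); apply/oeqP; exact: oeq_mulDl.
Qed.
Lemma omulDr : right_distributive omul oadd.
Proof.
elim/osp_quotW=> t; elim/osp_quotW=> u; elim/osp_quotW=> v.
by rewrite !(oaddE, omulE); apply/oeqP; exact: oeq_mulDr.
Qed.
Lemma ocstD : {morph ocst : c d / c + d >-> oadd c d}.
Proof. by move=> c d; rewrite oaddE; apply/oeqP; exact: oeq_cstD. Qed.
Lemma ocstM : {morph ocst : c d / c * d >-> omul c d}.
Proof. by move=> c d; rewrite omulE; apply/oeqP; exact: oeq_cstM. Qed.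
Lemma oaddN : left_inverse (ocst 0) (omul (ocst (-1))) oadd.
Proof.
move=> x; rewrite -{2}[x]omul1l -omulDl -ocstD addNr.
by elim/osp_quotW: x => t; rewrite omulE; apply/oeqP; exact: oeq_mul0.
Qed.
HB.instance Definition _ := GRing.isZmodule.Build osp oaddA oaddC oadd0 oaddN.

Section Eval.
Variables (W : algType F) (v : osp_gen -> W).

Fixpoint osp_eval (t : osp_term) : W :=
  match t with
  | Gen g => v g
  | Cst c => c%:A
  | Add t u => osp_eval t + osp_eval u
  | Mul t u => osp_eval t * osp_eval u
  end.

Definition osp_lift (x : osp) : W := osp_eval (repr x).

Hypothesis v_rel : forall t u, osp_rel t u -> osp_eval t = osp_eval u.

Lemma osp_eval_eq t u : osp_eq t u -> osp_eval t = osp_eval u.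
Proof.
elim=> /= {t u} //.
- by move=> t u w _ -> _ ->.
- by move=> t t' u u' _ -> _ ->.
- by move=> t t' u u' _ -> _ ->.
- by move=> t u w; rewrite addrA.
- by move=> t u; rewrite addrC.
- by move=> t; rewrite scale0r add0r.
- by move=> t u w; rewrite mulrA.
- by move=> t; rewrite scale1r mul1r.
- by move=> t; rewrite scale0r mul0r.
- by move=> t u w; rewrite mulrDl.
- by move=> t u w; rewrite mulrDr.
- by move=> c d; rewrite scalerDl.
- by move=> c d; rewrite -scalerAl mul1r scalerA.
- by move=> c t; rewrite -scalerAl -scalerAr mul1r mulr1.
Qed.

Lemma osp_lift_pi t : osp_lift (\pi_osp t) = osp_eval t.
Proof. by apply: osp_eval_eq; exact: repr_oeq. Qed.

End Eval.

Lemma osp_one_neq0 : ocst 1 != 0.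
Proof.
pose v g : F^o := match g with GAp | GAm => 0 | _ => 1 end.
apply/eqP => /(congr1 (osp_lift v)).
have v_rel t u : osp_rel t u -> osp_eval v t = osp_eval v u.
  by case=> /=; rewrite ?(mulr0, mul0r, mulr1, mul1r, addr0, scale0r, scale1r,
    scaleN1r, mulNr, mul1r, addrN, scaler0).
rewrite !osp_lift_pi //= scale1r scale0r => /eqP; by rewrite oner_eq0.
Qed.

HB.instance Definition _ := GRing.Zmodule_isNzRing.Build osp
  omulA omul1l omul1r omulDl omulDr osp_one_neq0.

Definition oscale (c : F) (x : osp) : osp := omul (ocst c) x.
Lemma oscaleA c d x : oscale c (oscale d x) = oscale (c * d) x.
Proof. by rewrite /oscale omulA ocstM. Qed.
Lemma oscale1 : left_id 1 oscale.
Proof. exact: omul1l. Qed.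
Lemma oscaleDr : right_distributive oscale +%R.
Proof. by move=> c x y; exact: omulDr. Qed.
Lemma oscaleDl x : {morph oscale^~ x : c d / c + d}.
Proof. by move=> c d; rewrite /oscale ocstD; exact: omulDl. Qed.
HB.instance Definition _ := GRing.Zmodule_isLmodule.Build F osp
  oscaleA oscale1 oscaleDr oscaleDl.
Lemma oscaleAl c (x y : osp) : c *: (x * y) = (c *: x) * y.
Proof. exact: omulA. Qed.
HB.instance Definition _ := GRing.Lmodule_isLalgebra.Build F osp oscaleAl.
Lemma oscaleAr c (x y : osp) : c *: (x * y) = x * (c *: y).
Proof.
rewrite [LHS]omulA [RHS]omulA; congr omul; exact: ocstC.
Qed.
HB.instance Definition _ := GRing.Lalgebra_isAlgebra.Build F osp oscaleAr.

Lemma ocstE c : \pi_osp (Cst c) = c%:A.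
Proof. by rewrite [RHS]omul1r. Qed.

Section LiftMorphism.
Variables (W : algType F) (v : osp_gen -> W).
Hypothesis v_rel : forall t u, osp_rel t u -> osp_eval v t = osp_eval v u.

Lemma osp_lift_linear : linear (osp_lift v).
Proof.
move=> c; elim/osp_quotW=> t; elim/osp_quotW=> u.
rewrite [_ *: _]omulE [_ + _]oaddE !osp_lift_pi //=.
by rewrite -scalerAl mul1r.
Qed.
Lemma osp_lift_monoid : monoid_morphism (osp_lift v).
Proof.
split; first by rewrite [LHS]osp_lift_pi //= scale1r.
elim/osp_quotW=> t; elim/osp_quotW=> u.
by rewrite [_ * _]omulE !osp_lift_pi.
Qed.
End LiftMorphism.

Definition osp_g (g : osp_gen) : osp := \pi_osp (Gen g).
Definition Ap := osp_g GAp.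
Definition Am := osp_g GAm.
Definition K := osp_g GK.
Definition Ki := osp_g GKi.
Definition P := osp_g GP.

Lemma osp_evalE t : osp_eval osp_g t = \pi_osp t.
Proof.
elim: t => [g|c|t IHt u IHu|t IHt u IHu] /=; rewrite ?IHt ?IHu ?ocstE //.
  exact: oaddE.
exact: omulE.
Qed.

Lemma osp_relE t u : osp_rel t u -> osp_eval osp_g t = osp_eval osp_g u.
Proof. by move=> tu; rewrite !osp_evalE; apply/oeqP/oeq_rel. Qed.

Lemma KAp : K * Ap * Ki = s *: Ap.
Proof. by rewrite [LHS](osp_relE osp_KAp) /= mulr_algl. Qed.
Lemma KAm : K * Am * Ki = s^-1 *: Am.
Proof. by rewrite [LHS](osp_relE osp_KAm) /= mulr_algl. Qed.
Lemma ApAm : Ap * Am + Am * Ap = (s - s^-1)^-1 *: (K ^+ 2 - Ki ^+ 2).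
Proof. by rewrite [LHS](osp_relE osp_ApAm) /= !mulr_algl scaleN1r. Qed.
Lemma PAp : P * Ap = - (Ap * P).
Proof. by apply/eqP; rewrite -addr_eq0 [_ + _](osp_relE osp_PAp) /= scale0r. Qed.
Lemma PAm : P * Am = - (Am * P).
Proof. by apply/eqP; rewrite -addr_eq0 [_ + _](osp_relE osp_PAm) /= scale0r. Qed.
Lemma PK : P * K = K * P.
Proof.
apply/eqP; rewrite -subr_eq0; have := osp_relE osp_PK.
by rewrite /= mulr_algl scaleN1r scale0r => ->.
Qed.
Lemma PKi : P * Ki = Ki * P.
Proof.
apply/eqP; rewrite -subr_eq0; have := osp_relE osp_PKi.
by rewrite /= mulr_algl scaleN1r scale0r => ->.
Qed.
Lemma KKi : K * Ki = 1.
Proof. by rewrite [LHS](osp_relE osp_KKi) /= scale1r. Qed.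
Lemma KiK : Ki * K = 1.
Proof. by rewrite [LHS](osp_relE osp_KiK) /= scale1r. Qed.
Lemma PP : P * P = 1.
Proof. by rewrite [LHS](osp_relE osp_PP) /= scale1r. Qed.

Definition Delta_gen (g : osp_gen) : tensor osp osp :=
  match g with
  | GAp => Ap ⊗ (K * P) + Ki ⊗ Ap
  | GAm => Am ⊗ (K * P) + Ki ⊗ Am
  | GK => K ⊗ K
  | GKi => Ki ⊗ Ki
  | GP => P ⊗ P
  end.

Lemma pure_mul (a b a' b' : osp) : (a ⊗ b) * (a' ⊗ b') = (a * a') ⊗ (b * b').
Proof. exact: tmul_pure. Qed.

Lemma pureNl (a b : osp) : (- a) ⊗ b = - (a ⊗ b).
Proof. by rewrite -scaleN1r pureZl scaleN1r. Qed.
Lemma pureNr (a b : osp) : a ⊗ (- b) = - (a ⊗ b).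
Proof. by rewrite -scaleN1r pureZr scaleN1r. Qed.

Lemma ApKi : Ap * Ki = s *: (Ki * Ap).
Proof. by rewrite scalerAr -KAp !mulrA KiK mul1r. Qed.
Lemma AmKi : Am * Ki = s^-1 *: (Ki * Am).
Proof. by rewrite scalerAr -KAm !mulrA KiK mul1r. Qed.
Lemma KAp' : K * Ap = s *: (Ap * K).
Proof. by rewrite scalerAl -KAp -(mulrA _ Ki K) KiK mulr1. Qed.
Lemma KAm' : K * Am = s^-1 *: (Am * K).
Proof. by rewrite scalerAl -KAm -(mulrA _ Ki K) KiK mulr1. Qed.

Lemma Delta_rel t u :
  osp_rel t u -> osp_eval Delta_gen t = osp_eval Delta_gen u.
Proof.
have KPKi : K * (K * P) * Ki = K * P.
  by rewrite -!mulrA PKi [K * (Ki * P)]mulrA KKi mul1r.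
case=> /=.
- rewrite mulrDr mulrDl !pure_mul KKi mul1r KAp KPKi !mulr_algl.
  by rewrite pureZl pureZr scalerDr.
- rewrite mulrDr mulrDl !pure_mul KKi mul1r KAm KPKi !mulr_algl.
  by rewrite pureZl pureZr scalerDr.
- rewrite !mulr_algl scaleN1r !mulrDl !mulrDr !pure_mul.
  have [s0|s0] := eqVneq s 0.
    have A0 (A : osp) : K * A * Ki = 0 -> A = 0.
      move=> A0; rewrite -[A]mul1r -[1 * A]mulr1 -KiK -(mulrA Ki K A).
      by rewrite mulrA -(mulrA Ki) A0 mulr0 mul0r.
    have -> : Ap = 0 by apply: A0; rewrite KAp s0 scale0r.
    have -> : Am = 0 by apply: A0; rewrite KAm s0 invr0 scale0r.
    rewrite !(mul0r, mulr0) s0 invr0 subrr invr0 scale0r.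
    have p0 (a : osp) : a ⊗ (0 : osp) = 0 by rewrite -(scale0r 0) pureZr scale0r.
    have p0' (a : osp) : (0 : osp) ⊗ a = 0 by rewrite -(scale0r 0) pureZl scale0r.
    by rewrite !(p0, p0') !addr0.
  have KPKP : K * P * (K * P) = K * K.
    by rewrite -!mulrA (mulrA P K P) PK -(mulrA K P P) PP mulr1.
  have E1 : (Ap * Ki) ⊗ (K * P * Am) = - ((Ki * Ap) ⊗ (Am * (K * P))).
    rewrite -(mulrA K P) PAm mulrN pureNr (mulrA K Am) KAm' ApKi -scalerAl mulrA.
    by rewrite pureZr pureZl scalerA mulVf // scale1r.
  have E2 : (Am * Ki) ⊗ (K * P * Ap) = - ((Ki * Am) ⊗ (Ap * (K * P))).
    rewrite -(mulrA K P) PAp mulrN pureNr (mulrA K Ap) KAp' AmKi -scalerAl mulrA.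
    by rewrite pureZr pureZl scalerA mulfV // scale1r.
  rewrite E1 E2 KPKP.
  have sum8 (a b c d e f : tensor osp osp) :
      a + - b + (c + d) + (e + - c + (b + f)) = a + e + (d + f).
    by rewrite !addrA (ACl (1*5*2*7*3*6*4*8))/= addrNK addrK.
  rewrite sum8 -pureDl -pureDr ApAm pureZl pureZr -scalerDr !expr2.
  congr (_ *: _); rewrite pureDl pureDr pureNl pureNr.
  by rewrite addrA subrK.
- rewrite mulrDr mulrDl !pure_mul PAp PKi !pureNl !pureNr scale0r.
  by rewrite mulrA PK addrACA !addNr addr0.
- rewrite mulrDr mulrDl !pure_mul PAm PKi !pureNl !pureNr scale0r.
  by rewrite mulrA PK addrACA !addNr addr0.
- by rewrite !pure_mul PK mulr_algl scaleN1r addrN scale0r.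
- by rewrite !pure_mul PKi mulr_algl scaleN1r addrN scale0r.
- by rewrite !pure_mul KKi scale1r.
- by rewrite !pure_mul KiK scale1r.
- by rewrite !pure_mul PP scale1r.
Qed.

Definition Delta : osp -> tensor osp osp := osp_lift Delta_gen.
HB.instance Definition _ := GRing.isLinear.Build F osp (tensor osp osp) _ Delta
  (osp_lift_linear Delta_rel).
HB.instance Definition _ := GRing.isMonoidMorphism.Build osp (tensor osp osp) Delta
  (osp_lift_monoid Delta_rel).

Lemma Delta_g g : Delta (osp_g g) = Delta_gen g.
Proof. exact: osp_lift_pi Delta_rel _. Qed.

Definition Casimir : osp :=
  (- (Ap * Am) + (q - q^-1)^-1 *: (s^-1 *: K ^+ 2 - s *: Ki ^+ 2)) * P.

Definition coideal_gen (x : osp) : Prop :=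
  [\/ x = Am * K, x = Ap * K, x = K ^+ 2 * P | x = Casimir].

(* The subalgebra on which the coaction tau is defined. *)
Definition coideal := subalg coideal_gen.
HB.instance Definition _ := GRing.Algebra.on coideal.
HB.instance Definition _ := SubChoice.on coideal.

Lemma coideal_AmK : Am * K \in gen_subalg coideal_gen.
Proof. by apply: mem_gen_subalg; constructor 1. Qed.
Lemma coideal_ApK : Ap * K \in gen_subalg coideal_gen.
Proof. by apply: mem_gen_subalg; constructor 2. Qed.
Lemma coideal_K2P : K ^+ 2 * P \in gen_subalg coideal_gen.
Proof. by apply: mem_gen_subalg; constructor 3. Qed.
Lemma coideal_Casimir : Casimir \in gen_subalg coideal_gen.
Proof. by apply: mem_gen_subalg; constructor 4. Qed.

Definition iAmK : coideal := Sub (Am * K) coideal_AmK.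
Definition iApK : coideal := Sub (Ap * K) coideal_ApK.
Definition iK2P : coideal := Sub (K ^+ 2 * P) coideal_K2P.
Definition iCasimir : coideal := Sub Casimir coideal_Casimir.

Definition is_coaction (tau : coideal -> tensor osp coideal) : Prop :=
  [/\ tau iAmK = (K ^+ 2 * P) ⊗ iAmK,
      tau iApK = (Ki ^+ 2 * P) ⊗ iApK
        + (s^-1 * (q - q^-1)) *: ((Ap ^+ 2 * P) ⊗ iAmK)
        + (s^-1 * (s - s^-1)) *: ((Ap * Ki * P) ⊗ iK2P)
        + (s^-1 * (q - q^-1)) *: ((Ap * Ki * P) ⊗ iCasimir),
      tau iK2P = 1 ⊗ iK2P - (q - q^-1) *: ((Ap * K) ⊗ iAmK)
    & tau iCasimir = 1 ⊗ iCasimir].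

(* Left-nested powers starting from the ground field: tpow m.+1 is
   ((F (x) osp) (x) osp) (x) ... with m.+1 factors osp. *)
Fixpoint tpow (n : nat) : algType F :=
  if n is m.+1 then tensor (tpow m) osp else F^o.

Definition Delta_last m : tpow m.+1 -> tpow m.+2 := tassoc \o tmap idfun Delta.
HB.instance Definition _ m := GRing.Linear.on (@Delta_last m).

Section Gamma.
Variable tau : {lrmorphism coideal -> tensor osp coideal}.

(* 1 (x) ... (x) 1 (x) tau, for elements whose last factor lies in coideal. *)
Definition tau_last m : tpow m.+1 -> tpow m.+2 :=
  tassoc \o tmap idfun (tmap idfun \val)
         \o tmap idfun tau \o tmap idfun (subalg_proj coideal_gen).

(* b and c tell whether k-1 and k belong to A. When the last index processed is
   not in A there is one tensor factor more than positions processed, whence the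
   offsets ~~ b and ~~ c. *)
Definition step (b c : bool) (m : nat) :
    tpow (~~ b + m.+1) -> tpow (~~ c + m.+2) :=
  match b, c with
  | true, true => @Delta_last m
  | true, false => @tau_last m.+1 \o @Delta_last m
  | false, false => tmap (@Delta_last m) idfun
  | false, true => idfun
  end.

(* r lists the membership in A of the positions a+1, a+2, ..., in reverse order,
   position a being in A (positions are numbered from 0). The a leading factors 1
   are put in place from the start and left untouched by every step. *)
Fixpoint chain (a : nat) (r : bitseq) :
    tpow (~~ head true r + (size r + a).+1) :=
  match r with
  | [::] => (1 : tpow a) ⊗ Casimir
  | c :: r' => step c (chain a r')
  end.

Fixpoint rpad (d m : nat) (x : tpow m) : tpow (d + m) :=
  if d is d'.+1 then rpad d' x ⊗ (1 : osp) else x.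

(* Only applied when m = n holds (as it does in Gamma below, for A nonempty). *)
Definition tcast (m n : nat) (x : tpow m) : tpow n :=
  if m =P n is ReflectT e then ecast k (tpow k) e x else 0.

(* The set {1, ..., n} is represented by 'I_n, i standing for i + 1. *)
Section GammaSet.
Variables (n : nat) (A : {set 'I_n}).

Definition smin : nat := \big[minn/n]_(i in A) i.
Definition smax : nat := \max_(i in A) i.

Definition Gamma : tpow n :=
  if A == finset.set0 then (- ((s - s^-1) / (q - q^-1)))%:A
  else tcast n (rpad (n - smax.+1)%N (chain smin
         (rev [seq i \in A | i : 'I_n <- enum 'I_n & (smin < i <= smax)%N]))).

End GammaSet.
End Gamma.
End Osp.

Definition matches n (A B : {set 'I_n}) : Prop :=
  [/\ A :\: (A :&: B) != finset.set0, A :&: B != finset.set0,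
      B :\: (A :&: B) != finset.set0,
      (smax (A :\: (A :&: B)) < smin (A :&: B))%N
    & (smax (A :&: B) < smin (B :\: (A :&: B)))%N].

Definition consecutive n (A : {set 'I_n}) : Prop :=
  exists i j : 'I_n, A = [set k : 'I_n | (i <= k <= j)%N].

Definition qanticomm (F : fieldType) (s : F) (V : algType F) (X Y : V) : V :=
  s *: (X * Y) + s^-1 *: (Y * X).

(* Main.v *)
(* Write A1 = A \ B, A2 = A /\ B and A3 = B \ A; as A is an interval these are
   two consecutive intervals followed by an arbitrary set. By coassociativity
   of the coproduct and of the coaction tau, an algebra morphism from
   U (x) U (x) I to the n-th tensor power (iterated coproducts on the first two
   legs, iterated coactions and coproducts on the last one, I being a left
   coideal) sends the elements attached to the subsets of {1, 2, 3} to those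
   attached to the unions of the corresponding A_i. This leaves the case
   n = 3 with A1 = {1}, A2 = {2}, A3 = {3}, an identity in U (x) U (x) U which
   is checked by rewriting both sides to ordered monomials. *)
From HB Require Import structures.
Require Import Defs.
From mathcomp Require Import all_boot all_order all_algebra.
From mathcomp Require Import generic_quotient ssrAC boolp reals.
From mathcomp Require Import zify ring.
From mathcomp.real_closed Require Import complex.

Set Implicit Arguments.
Unset Strict Implicit.
Unset Printing Implicit Defensive.

Import GRing.Theory Num.Theory.
Local Open Scope ring_scope.
Local Open Scope quotient_scope.
Local Notation "a ⊗ b" := (pure a b) (at level 40).

(** * Morphisms between tensor products *)

(** The definition of [Gamma] reaches [tau] through [subalg_proj], an arbitrary linear retraction
    onto the coideal I, so its steps are linear but not visibly multiplicative. The recursion is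
    therefore replayed with the last tensor factor in I itself, where every step is an algebra
    morphism, and is compared with [chain] only after including I into U. This inclusion stays
    injective after tensoring, because the retraction splits it; identities in U ⊗ U ⊗ I can thus be
    tested in U ⊗ U ⊗ U. Gaps in a set are the delicate point: inside a gap the definition applies
    the coproduct to the next-to-last factor instead of [tau] to the last one. Coassociativity of
    [tau] makes the two agree, so a gap of any length is a power of [tau], and a skipped zone A2 is
    just a longer gap. The computation on three legs uses integer coefficients: s and s^-1 are
    letters, (s - s^-1) A_- replaces A_-, and each element is multiplied by w = q - q^-1 = (s +
    s^-1)(s - s^-1), which is nonzero because |q| differs from 1. *)

Section TensorMorphisms.
Variables (F : fieldType).

Section Pure.
Variables (A B : algType F).

Lemma pureM (a a' : A) (b b' : B) : (a ⊗ b) * (a' ⊗ b') = (a * a') ⊗ (b * b').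
Proof. exact: tmul_pure. Qed.

Lemma pure0r (a : A) : a ⊗ (0 : B) = 0.
Proof. by rewrite -(scale0r (0 : B)) pureZr scale0r. Qed.

Lemma pureNl (a : A) (b : B) : (- a) ⊗ b = - (a ⊗ b).
Proof. by rewrite -scaleN1r pureZl scaleN1r. Qed.

Lemma pureNr (a : A) (b : B) : a ⊗ (- b) = - (a ⊗ b).
Proof. by rewrite -scaleN1r pureZr scaleN1r. Qed.

Lemma tensor_linear_ext (V : lmodType F) (f g : {linear tensor A B -> V}) :
  (forall a b, f (a ⊗ b) = g (a ⊗ b)) -> f =1 g.
Proof.
move=> fg x; elim/tensor_ind: x => [|a b x IH]; first by rewrite !linear0.
by rewrite !linearD IH fg.
Qed.

Definition inl_tensor (a : A) : tensor A B := a ⊗ 1.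
Definition inr_tensor (b : B) : tensor A B := 1 ⊗ b.

Lemma inl_tensor_linear : linear inl_tensor.
Proof. exact: pure_linl. Qed.

Lemma inl_tensor_monoid : monoid_morphism inl_tensor.
Proof. by split=> // a a'; rewrite /inl_tensor pureM mulr1. Qed.

Lemma inr_tensor_linear : linear inr_tensor.
Proof. exact: pure_linr. Qed.

Lemma inr_tensor_monoid : monoid_morphism inr_tensor.
Proof. by split=> // a a'; rewrite /inr_tensor pureM mulr1. Qed.

HB.instance Definition _ := GRing.isLinear.Build F A (tensor A B) _ inl_tensor
  inl_tensor_linear.
HB.instance Definition _ := GRing.isMonoidMorphism.Build A (tensor A B) inl_tensor
  inl_tensor_monoid.
HB.instance Definition _ := GRing.isLinear.Build F B (tensor A B) _ inr_tensor
  inr_tensor_linear.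
HB.instance Definition _ := GRing.isMonoidMorphism.Build B (tensor A B) inr_tensor
  inr_tensor_monoid.
End Pure.

Section Tmap.
Variables (A B A' B' : algType F).
Variables (f : {lrmorphism A -> A'}) (g : {lrmorphism B -> B'}).

Lemma tmap_monoid : monoid_morphism (tmap f g).
Proof.
split=> [|x y]; first by rewrite [LHS]tmap_pure !rmorph1.
elim/tensor_ind: x => [|a b x IHx]; first by rewrite !(mul0r, linear0).
rewrite !(mulrDl, linearD) /= IHx; congr (_ + _) => {IHx}.
elim/tensor_ind: y => [|a' b' y IHy]; first by rewrite !(mulr0, linear0).
by rewrite !(mulrDr, linearD) /= IHy pureM !tmap_pure pureM !rmorphM.
Qed.
HB.instance Definition _ :=
  GRing.isMonoidMorphism.Build (tensor A B) (tensor A' B') (tmap f g) tmap_monoid.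
End Tmap.

Section Tassoc.
Variables (A B C : algType F).
Notation assoc := (@tassoc F A B C).

Lemma tassoc_monoid : monoid_morphism assoc.
Proof.
split=> [|x y]; first by rewrite [LHS]tassoc_pure.
elim/tensor_ind: x => [|a x' x IHx]; first by rewrite !(mul0r, linear0).
rewrite !(mulrDl, linearD) /= IHx; congr (_ + _) => {IHx}.
elim/tensor_ind: y => [|a' y' y IHy]; first by rewrite !(mulr0, linear0).
rewrite !(mulrDr, linearD) /= IHy pureM; congr (_ + _) => {IHy}.
elim/tensor_ind: x' => [|b c x' IHx]; first by rewrite !(mul0r, pure0r, linear0).
rewrite !(mulrDl, pureDr, linearD) /= IHx; congr (_ + _) => {IHx}.
elim/tensor_ind: y' => [|b' c' y' IHy]; first by rewrite !(mulr0, pure0r, linear0).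
rewrite !(mulrDr, pureDr, linearD) /= IHy; congr (_ + _).
by rewrite pureM !tassoc_pure !pureM.
Qed.
HB.instance Definition _ := GRing.isMonoidMorphism.Build
  (tensor A (tensor B C)) (tensor (tensor A B) C) assoc tassoc_monoid.
End Tassoc.

End TensorMorphisms.

(** * Normal ordering of words *)

(* In words, (0, 0) and (0, 1) stand for the scalars s and s^-1, and (l.+1, a)
   for the generator [osp_letter a] in the l-th leg. *)
Definition letter := (nat * nat)%type.
Definition ncpoly := seq (int * seq letter).

Definition ncscale (c : int) (p : ncpoly) : ncpoly := [seq (c * t.1, t.2) | t <- p].
Definition ncbind (f : seq letter -> ncpoly) (p : ncpoly) : ncpoly :=
  flatten [seq ncscale t.1 (f t.2) | t <- p].
Definition ncword_mul (f : letter -> seq letter -> ncpoly) (u : seq letter) (p : ncpoly) :=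
  foldr (fun g => ncbind (f g)) p u.

Fixpoint ncadd_term (t : int * seq letter) (p : ncpoly) : ncpoly :=
  if p is t' :: p' then
    if t.2 == t'.2 then (t.1 + t'.1, t.2) :: p' else t' :: ncadd_term t p'
  else [:: t].
Definition ncadd (p q : ncpoly) : ncpoly := foldr ncadd_term q p.
Definition nczero (p : ncpoly) : bool := all (fun t => t.1 == 0) p.

Section Rewriting.
Variable rule : letter -> letter -> option ncpoly.

(* Running out of fuel leaves a word unsorted, which is harmless: see
   [nceval_insert]. *)
Fixpoint ncinsert (n : nat) (g : letter) (w : seq letter) : ncpoly :=
  if n is n'.+1 then
    if w is h :: w' then
      if rule g h is Some p then
        ncbind (fun u => ncword_mul (ncinsert n') u [:: (1, w')]) p
      else [:: (1, g :: w)]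
    else [:: (1, [:: g])]
  else [:: (1, g :: w)].

(** The outer [ncadd] merges equal words, so that intermediate products stay small and cancellations
    show up as zero coefficients. *)
Definition ncmul (p q : ncpoly) : ncpoly :=
  ncadd (ncbind (fun u => ncword_mul (ncinsert 100) u q) p) [::].

Variables (W : pzRingType) (v : letter -> W).

Definition weval (w : seq letter) : W := \prod_(g <- w) v g.
Definition nceval (p : ncpoly) : W := \sum_(t <- p) weval t.2 *~ t.1.

Lemma nceval_cat p q : nceval (p ++ q) = nceval p + nceval q.
Proof. exact: big_cat. Qed.

Lemma nceval_cons t p : nceval (t :: p) = weval t.2 *~ t.1 + nceval p.
Proof. exact: big_cons. Qed.

Lemma nceval1 c w : nceval [:: (c, w)] = weval w *~ c.
Proof. exact: big_seq1. Qed.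

Lemma nceval_scale c p : nceval (ncscale c p) = nceval p *~ c.
Proof.
rewrite /nceval big_map; elim/big_rec2: _ => [|t x y _ ->]; first by rewrite mul0rz.
by rewrite /= mulrzDl mulrC mulrzA.
Qed.

Lemma nceval_bind f z p : (forall u, nceval (f u) = weval u * z) ->
  nceval (ncbind f p) = nceval p * z.
Proof.
move=> fz; elim: p => [|t p IH]; first by rewrite [RHS]mulr_suml /nceval !big_nil.
rewrite [ncbind _ _]/(_ ++ ncbind f p) nceval_cat IH nceval_scale fz.
by rewrite nceval_cons mulrDl mulrzAl.
Qed.

Lemma nceval_bindl f z p : (forall u, nceval (f u) = z * weval u) ->
  nceval (ncbind f p) = z * nceval p.
Proof.
move=> fz; elim: p => [|t p IH]; first by rewrite [RHS]mulr_sumr /nceval !big_nil.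
rewrite [ncbind _ _]/(_ ++ ncbind f p) nceval_cat IH nceval_scale fz.
by rewrite nceval_cons mulrDr mulrzAr.
Qed.

Lemma nceval_word_mul f u p : (forall g w, nceval (f g w) = v g * weval w) ->
  nceval (ncword_mul f u p) = weval u * nceval p.
Proof.
move=> fv; elim: u => [|g u IH]; first by rewrite /weval big_nil mul1r.
by rewrite /= (nceval_bindl _ (fv g)) IH mulrA /weval big_cons.
Qed.

Lemma nceval_add p q : nceval (ncadd p q) = nceval p + nceval q.
Proof.
elim: p => [|t p IH]; first by rewrite [nceval [::]]big_nil add0r.
rewrite /= nceval_cons -addrA -IH; elim: (ncadd p q) => [|t' r IHr]; first exact:
  nceval_cons.
rewrite [LHS]/=; case: eqP => [tt'|_]; rewrite !nceval_cons.
  by rewrite /= mulrzDr tt' addrA.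
by rewrite IHr addrCA.
Qed.

Lemma nczeroP p : nczero p -> nceval p = 0.
Proof.
elim: p => [|t p IH]; first by rewrite /nceval big_nil.
by case/andP => /eqP t0 /IH; rewrite nceval_cons t0 mulr0z add0r.
Qed.

Hypothesis ruleP : forall g h p, rule g h = Some p -> v g * v h = nceval p.

Lemma nceval_insert n g w : nceval (ncinsert n g w) = v g * weval w.
Proof.
elim: n g w => [|n IH] g w /=; first by rewrite nceval1 /weval big_cons.
case: w => [|h w]; first by rewrite nceval1 /weval big_seq1 big_nil mulr1.
case E: (rule g h) => [p|]; last by rewrite nceval1 /weval big_cons.
(* The rule replaces the pair [g h] by [p]; the untouched tail [w] is the right factor of every
   term. *)
rewrite (nceval_bind (z := weval w)) => [|u].
  by rewrite -(ruleP E) /weval big_cons mulrA.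
by rewrite nceval_word_mul // nceval1.
Qed.

Lemma nceval_mul p q : nceval (ncmul p q) = nceval p * nceval q.
Proof.
rewrite /ncmul nceval_add [nceval [::]]big_nil addr0.
apply: nceval_bind => u; apply: nceval_word_mul; exact: nceval_insert.
Qed.
End Rewriting.

(** Letters are ordered as A_+, B, K, K^-1, P, with B standing for (s - s^-1) A_-. The
    anticommutator then reads B A_+ = -A_+ B + K^2 - K^-2. *)
Definition osp_rule (l a b : nat) : option ncpoly :=
  let Ap := (l, 0%N) in let B := (l, 1%N) in let K := (l, 2%N) in
  let Ki := (l, 3%N) in let P := (l, 4%N) in
  let s := (0%N, 0%N) in let si := (0%N, 1%N) in
  match a, b with
  | 1, 0 => Some [:: (-1, [:: Ap; B]); (1, [:: K; K]); (-1, [:: Ki; Ki])]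
  | 2, 0 => Some [:: (1, [:: s; Ap; K])]
  | 3, 0 => Some [:: (1, [:: si; Ap; Ki])]
  | 2, 1 => Some [:: (1, [:: si; B; K])]
  | 3, 1 => Some [:: (1, [:: s; B; Ki])]
  | 4, 0 => Some [:: (-1, [:: Ap; P])]
  | 4, 1 => Some [:: (-1, [:: B; P])]
  | 4, 2 => Some [:: (1, [:: K; P])]
  | 4, 3 => Some [:: (1, [:: Ki; P])]
  | 2, 3 | 3, 2 | 4, 4 => Some [:: (1, [::])]
  | _, _ => None
  end.

(** Scalars move to the front, where s cancels against s^-1. Leg l has tag l + 1, tag 0 being
    reserved for scalars; hence the bound [g.1 <= r] here against [k < r] in the hypothesis
    [legC]. *)
Definition legs_rule (r : nat) (g h : letter) : option ncpoly :=
  if h.1 == 0%N then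
    if g.1 == 0%N then
      if (g.2 == 0%N) == (h.2 == 0%N) then None else Some [:: (1, [::])]
    else Some [:: (1, [:: h; g])]
  else if g.1 == 0%N then None
  else if g.1 == h.1 then osp_rule g.1 g.2 h.2
  else if (h.1 < g.1 <= r)%N then Some [:: (1, [:: h; g])] else None.

(** * Soundness of the rules in an algebra with commuting legs *)

Section Legs.
Variables (F : fieldType) (s : F).
Hypotheses (s0 : s != 0) (s1 : s - s^-1 != 0).
Local Notation osp := (osp s).

(* Rescaling [Am] makes all structure constants Laurent polynomials in s. *)
Definition osp_letter (g : nat) : osp :=
  match g with
  | 0 => Ap s | 1 => (s - s^-1) *: Am s | 2 => K s | 3 => Ki s | _ => P s
  end.

Variables (W : algType F) (r : nat) (leg : nat -> {lrmorphism osp -> W}).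
Hypothesis legC : forall l k a b, (l < k < r)%N -> leg k b * leg l a = leg l a * leg k b.

Definition legs_letter (g : letter) : W :=
  match g with
  | (0, 0) => s%:A | (0, _) => s^-1%:A | (l.+1, a) => leg l (osp_letter a)
  end.

Lemma KiAp : Ki s * Ap s = s^-1 *: (Ap s * Ki s).
Proof. by rewrite ApKi scalerA mulVf // scale1r. Qed.

Lemma KiAm : Ki s * Am s = s *: (Am s * Ki s).
Proof. by rewrite AmKi scalerA mulfV // scale1r. Qed.

Lemma osp_ruleP l a b p : osp_rule l.+1 a b = Some p ->
  leg l (osp_letter a) * leg l (osp_letter b) = nceval legs_letter p.
Proof.
case: a => [|[|[|[|[|[]]]]]] //; case: b => [|[|[|[|[|[]]]]]] //= [<-];
  rewrite /nceval ?big_cons ?big_nil /weval ?big_cons ?big_nil /= ?mulr1 ?addr0;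
  rewrite ?mulr1z ?mulN1r ?mulrN1z ?mulr_algl -?rmorphM /=.
- rewrite -scalerAl -scalerAr -linearN -linearB -linearD /=; congr (leg l _).
  have -> : Am s * Ap s = (s - s^-1)^-1 *: (K s ^+ 2 - Ki s ^+ 2) - Ap s * Am s.
    by rewrite -ApAm addrC addKr.
  by rewrite scalerBr scalerA mulfV // scale1r addrC.
- by rewrite KAp' linearZ.
- by rewrite -scalerAr KAm' -scalerAl scalerA mulrC -scalerA linearZ.
- by rewrite KKi rmorph1.
- by rewrite KiAp linearZ.
- by rewrite -scalerAr KiAm -scalerAl scalerA mulrC -scalerA linearZ.
- by rewrite KiK rmorph1.
- by rewrite PAp linearN.
- by rewrite -scalerAr PAm scalerN -scalerAl linearN.
- by rewrite PK.
- by rewrite PKi.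
- by rewrite PP rmorph1.
Qed.

Lemma legs_ruleP g h p : legs_rule r g h = Some p ->
  legs_letter g * legs_letter h = nceval legs_letter p.
Proof.
case: g h => [[|l] a] [[|k] b]; rewrite /legs_rule [_.1]/= [_.2]/=.
- have sK : s%:A * s^-1%:A = 1 :> W by rewrite mulr_algl scalerA mulfV // scale1r.
  have Ks : s^-1%:A * s%:A = 1 :> W by rewrite mulr_algl scalerA mulVf // scale1r.
  by case: a b => [|a] [|b] //= [<-]; rewrite nceval1 /weval big_nil mulr1z.
- by [].
- case=> <-; rewrite nceval1 /weval !big_cons big_nil mulr1 mulr1z /=.
  by case: b => [|b]; rewrite mulr_algl mulr_algr.
- rewrite eqSS /=; case: eqP => [->|_]; first exact: osp_ruleP.
  case: ifP => // kl [<-]; rewrite nceval1 /weval !big_cons big_nil mulr1 mulr1z /=.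
  by rewrite legC.
Qed.

Local Notation ev := (nceval legs_letter).

Lemma legs_eval_mul p q : ev (ncmul (legs_rule r) p q) = ev p * ev q.
Proof. exact: nceval_mul legs_ruleP _ _. Qed.

End Legs.

(** * The coproduct and the coaction on the coideal *)

Section Coideal.
Variables (F : fieldType) (s : F).
Hypotheses (s0 : s != 0) (sp0 : s + s^-1 != 0) (sm0 : s - s^-1 != 0).
Local Notation q := (s ^+ 2).
Local Notation osp := (osp s).
Local Notation Ap := (Ap s).
Local Notation Am := (Am s).
Local Notation K := (K s).
Local Notation Ki := (Ki s).
Local Notation P := (P s).
Local Notation Cas := (Casimir s).

Lemma omegaE : q - q^-1 = (s + s^-1) * (s - s^-1).
Proof. by rewrite -exprVn; ring. Qed.

Lemma omega_neq0 : q - q^-1 != 0.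
Proof. by rewrite omegaE mulf_neq0. Qed.

Lemma CasimirE : Cas = - (Ap * Am * P)
  + (q - q^-1)^-1 *: (s^-1 *: (K ^+ 2 * P) - s *: (Ki ^+ 2 * P)).
Proof. by rewrite /Casimir mulrDl mulNr -scalerAl mulrBl -!scalerAl. Qed.

Lemma Delta_Ap : Delta Ap = Ap ⊗ (K * P) + Ki ⊗ Ap.
Proof. exact: Delta_g. Qed.

Lemma Delta_Am : Delta Am = Am ⊗ (K * P) + Ki ⊗ Am.
Proof. exact: Delta_g. Qed.

Lemma Delta_K : Delta K = K ⊗ K.
Proof. exact: Delta_g. Qed.

Lemma Delta_Ki : Delta Ki = Ki ⊗ Ki.
Proof. exact: Delta_g. Qed.

Lemma Delta_P : Delta P = P ⊗ P.
Proof. exact: Delta_g. Qed.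

Lemma Delta_AmK : Delta (Am * K) = (Am * K) ⊗ (K ^+ 2 * P) + 1 ⊗ (Am * K).
Proof.
rewrite rmorphM /= Delta_Am Delta_K mulrDl !pureM KiK.
by rewrite -(mulrA K) PK mulrA expr2.
Qed.

Lemma Delta_ApK : Delta (Ap * K) = (Ap * K) ⊗ (K ^+ 2 * P) + 1 ⊗ (Ap * K).
Proof.
rewrite rmorphM /= Delta_Ap Delta_K mulrDl !pureM KiK.
by rewrite -(mulrA K) PK mulrA expr2.
Qed.

Lemma Delta_K2P : Delta (K ^+ 2 * P) = (K ^+ 2 * P) ⊗ (K ^+ 2 * P).
Proof. by rewrite rmorphM rmorphXn /= Delta_K Delta_P !expr2 !pureM. Qed.

Lemma KPKP : K * P * (K * P) = K ^+ 2.
Proof. by rewrite -!mulrA (mulrA P K P) PK -(mulrA K P P) PP mulr1. Qed.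

(** The right factors are the four generators of the coideal. The correction (s + s^-1)^-1 K^-2 P
    cancels the terms K^-2 P ⊗ K^2 P contributed by Cas ⊗ K^2 P and K^-2 P ⊗ Cas, which are absent
    from the coproduct. *)
Lemma Delta_Casimir : Delta Cas =
  (s^-1 *: (Ap * Ki * P)) ⊗ (Am * K) + (- (Ki * Am * P)) ⊗ (Ap * K)
  + (Cas + (s + s^-1)^-1 *: (Ki ^+ 2 * P)) ⊗ (K ^+ 2 * P)
  + (Ki ^+ 2 * P) ⊗ Cas.
Proof.
rewrite CasimirE !(linearD, linearN, linearZ) /= !(rmorphM, rmorphXn) /=.
rewrite Delta_Ap Delta_Am Delta_K Delta_Ki Delta_P !expr2 !pureM.
rewrite !(mulrDl, mulrDr) !pureM KPKP.
have -> : K * P * Am * P = - (s^-1 *: (Am * K)).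
  by rewrite -(mulrA K) PAm mulrN mulNr mulrA -mulrA PP mulr1 KAm'.
have -> : Ap * (K * P) * P = Ap * K by rewrite -!mulrA PP mulr1.
rewrite !(pureDl, pureDr, pureNl, pureNr, pureZl, pureZr) -!expr2.
have -> : (s + s^-1)^-1 = (q - s ^- 2)^-1 * s - (q - s ^- 2)^-1 * s^-1.
  by rewrite -mulrBr omegaE invfM divfK.
rewrite !scalerN scalerBl !scalerDr !scalerN !scalerA ![s^-1 * _]mulrC !opprD !opprK !addrA.
by rewrite [RHS](ACl (3*1*2*8*4*10*5*6*7*9)) /= !subrK.
Qed.

Local Notation I := (coideal s).

Definition coideal_val : I -> osp := \val.
Lemma coideal_val_linear : linear coideal_val.
Proof. exact: (linearP (\val : {linear I -> osp})). Qed.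

Lemma coideal_val_monoid : monoid_morphism coideal_val.
Proof. by split=> // x y; exact: (rmorphM (\val : {rmorphism I -> osp})). Qed.
HB.instance Definition _ := GRing.isLinear.Build F I osp _ coideal_val
  coideal_val_linear.
HB.instance Definition _ := GRing.isMonoidMorphism.Build I osp coideal_val
  coideal_val_monoid.

Definition val_last (A : algType F) : tensor A I -> tensor A osp :=
  tmap (@idfun A) coideal_val.
HB.instance Definition _ A := GRing.Linear.on (@val_last A).
HB.instance Definition _ A := GRing.RMorphism.on (@val_last A).

Lemma val_last_pure (A : algType F) (a : A) (x : I) : val_last (a ⊗ x) = a ⊗ \val x.
Proof. exact: tmap_pure. Qed.

(** The linear retraction onto the coideal, tensored with the identity, is a left inverse. *)
Lemma val_last_inj (A : algType F) : injective (@val_last A).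
Proof.
pose p : {linear osp -> I} := @subalg_proj F osp (coideal_gen (s:=s)).
have pK x : p (\val x) = x by exact: subalg_projK.
apply: (can_inj (g := tmap (@idfun A) p)) => x.
elim/tensor_ind: x => [|a b x IH]; first by rewrite !linear0.
by rewrite !linearD /= IH val_last_pure tmap_pure pK.
Qed.

(** The values in U of the elements satisfying [Q] form a subalgebra containing the generators, and
    the coideal is the least such subalgebra. *)
Lemma coideal_ind (Q : I -> Prop) :
  subalg_closed (fun x => `[< Q x >]) ->
  Q (iAmK s) -> Q (iApK s) -> Q (iK2P s) -> Q (iCasimir s) -> forall x, Q x.
Proof.
move=> [Q1 Qlin QM] QAm QAp QK QC x.
pose D (y : osp) := `[< exists2 z : I, val z = y & Q z >].
have /gen_subalgP/(_ D) : val x \in gen_subalg (coideal_gen (s := s)) := valP x.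
suff Dsub : subalg_closed D.
  move/(_ Dsub) => xD; have /xD/asboolP[z /val_inj <-//] : forall y, coideal_gen y -> y
    \in D.
  move=> _ [] ->; apply/asboolP.
  - by exists (iAmK s).
  - by exists (iApK s).
  - by exists (iK2P s).
  - by exists (iCasimir s).
split=> [|c y z|y z].
- by apply/asboolP; exists 1; rewrite ?rmorph1 //; apply/asboolP.
- move=> /asboolP[y' <- Qy] /asboolP[z' <- Qz]; apply/asboolP.
  exists (c *: y' + z'); first by rewrite linearP.
  by apply/asboolP; apply: Qlin; apply/asboolP.
- move=> /asboolP[y' <- Qy] /asboolP[z' <- Qz]; apply/asboolP.
  exists (y' * z'); first by rewrite rmorphM.
  by apply/asboolP; apply: QM; apply/asboolP.
Qed.

Lemma coideal_morphism_ext (W : algType F) (f g : {lrmorphism I -> W}) :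
  f (iAmK s) = g (iAmK s) -> f (iApK s) = g (iApK s) ->
  f (iK2P s) = g (iK2P s) -> f (iCasimir s) = g (iCasimir s) -> f =1 g.
Proof.
move=> fgM fgQ fgN fgG; apply: coideal_ind => //; split=> [|c x y|x y].
- by apply/asboolP; rewrite !rmorph1.
- by move=> /asboolP fgx /asboolP fgy; apply/asboolP; rewrite !linearP /= fgx fgy.
- by move=> /asboolP fgx /asboolP fgy; apply/asboolP; rewrite !rmorphM /= fgx fgy.
Qed.

(** The left coideal property. It passes to sums and products because the coproduct is a morphism,
    and on generators the preimages are read off from the explicit coproducts. *)
Lemma Delta_coideal (x : I) : exists z : tensor osp I, val_last z = Delta (val x).
Proof.
apply: (coideal_ind (Q := fun x => exists z : tensor osp I, val_last z = Delta (val x))).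
- split=> [|c y z|y z].
  + by apply/asboolP; exists 1; rewrite !rmorph1.
  + move=> /asboolP[y' yE] /asboolP[z' zE]; apply/asboolP.
    by exists (c *: y' + z'); rewrite !linearP /= yE zE.
  + move=> /asboolP[y' yE] /asboolP[z' zE]; apply/asboolP.
    by exists (y' * z'); rewrite !rmorphM /= yE zE.
- exists ((Am * K) ⊗ iK2P s + 1 ⊗ iAmK s).
  by rewrite linearD /= !val_last_pure Delta_AmK.
- exists ((Ap * K) ⊗ iK2P s + 1 ⊗ iApK s).
  by rewrite linearD /= !val_last_pure Delta_ApK.
- exists ((K ^+ 2 * P) ⊗ iK2P s).
  by rewrite val_last_pure Delta_K2P.
- exists ((s^-1 *: (Ap * Ki * P)) ⊗ iAmK s + (- (Ki * Am * P)) ⊗ iApK s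
  + (Cas + (s + s^-1)^-1 *: (Ki ^+ 2 * P)) ⊗ iK2P s
  + (Ki ^+ 2 * P) ⊗ iCasimir s).
  by rewrite !linearD /= !val_last_pure Delta_Casimir.
Qed.

(** The corestriction of the coproduct to U ⊗ I: by [Delta_coideal] the retraction changes nothing
    on its values. A priori it is only linear. *)
Definition deltaI : I -> tensor osp I :=
  tmap idfun (subalg_proj (coideal_gen (s := s))) \o @Delta F s \o coideal_val.

Lemma val_deltaI x : val_last (deltaI x) = Delta (val x).
Proof.
have [z zE] := Delta_coideal x; rewrite /deltaI /= -zE; congr (val_last _).
elim/tensor_ind: z {zE} => [|a b z IH]; first by rewrite !linear0.
by rewrite !linearD /= IH val_last_pure tmap_pure /= subalg_projK.
Qed.

HB.instance Definition _ := GRing.Linear.on deltaI.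
(** Tested after the injective [val_last], where the map becomes the coproduct. *)
Lemma deltaI_monoid : monoid_morphism deltaI.
Proof.
split=> [|x y]; apply: val_last_inj; rewrite val_deltaI.
  by rewrite !rmorph1.
by rewrite [in RHS]rmorphM /= !val_deltaI -!rmorphM.
Qed.
HB.instance Definition _ := GRing.isMonoidMorphism.Build I (tensor osp I) deltaI
  deltaI_monoid.
Lemma coideal_Delta_exists :
  exists f : {lrmorphism I -> tensor osp I}, forall x, val_last (f x) = Delta (val x).
Proof. by exists deltaI; exact: val_deltaI. Qed.
End Coideal.

(** * Coassociativity of the coproduct and of the two coactions on the coideal *)

Section Comodule.
Variables (F : fieldType) (s : F).
Local Notation q := (s ^+ 2).
Local Notation U := (osp s).
Local Notation Ap := (Ap s).
Local Notation Am := (Am s).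
Local Notation K := (K s).
Local Notation Ki := (Ki s).
Local Notation P := (P s).
Local Notation Cas := (Casimir s).
Local Notation I := (coideal s).

(** The axiom of a left comodule; for [B := U] and the coproduct it is ordinary coassociativity. *)
Definition coassociative (B : algType F) (c : {lrmorphism B -> tensor U B}) :=
  forall y, tmap (@Delta F s) (@idfun B) (c y) = tassoc (tmap (@idfun U) c (c y)).

Lemma osp_morphism_ext (W : algType F) (f g : {lrmorphism U -> W}) :
  (forall x, f (osp_g s x) = g (osp_g s x)) -> f =1 g.
Proof.
move=> fg; elim/osp_quotW; elim=> [x|c|t IHt u IHu|t IHt u IHu].
- exact: fg.
- by rewrite ocstE !linearZ /= !rmorph1.
- by rewrite -oaddE ![_ (oadd _ _)]linearD /= IHt IHu.
- by rewrite -omulE ![_ (omul _ _)]rmorphM /= IHt IHu.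
Qed.

Lemma Delta_coassoc : coassociative (@Delta F s).
Proof.
apply: (osp_morphism_ext (f := tmap (@Delta F s) (@idfun U) \o @Delta F s)
  (g := tassoc \o tmap (@idfun U) (@Delta F s) \o @Delta F s)) => g.
rewrite /= Delta_g; case: g => /=;
  rewrite ?linearD /= ?tmap_pure /= ?Delta_g /= ?linearD /= ?tassoc_pure //.
- rewrite rmorphM /= !Delta_g /= pureM pureDl pureDr linearD /= !tassoc_pure.
  by rewrite addrA.
- rewrite rmorphM /= !Delta_g /= pureM pureDl pureDr linearD /= !tassoc_pure.
  by rewrite addrA.
Qed.

Hypotheses (s0 : s != 0) (sp0 : s + s^-1 != 0) (sm0 : s - s^-1 != 0).
Variable deltaI : {lrmorphism I -> tensor U I}.
Hypothesis val_deltaI : forall x, val_last (deltaI x) = Delta (val x).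

Lemma deltaI_coassoc : coassociative deltaI.
Proof.
move=> y; apply: val_last_inj; transitivity (tmap (@Delta F s) (@idfun U) (val_last
  (deltaI y))).
  elim/tensor_ind: (deltaI y) => [|a b z IH]; first by rewrite !linear0.
  by rewrite !linearD /= IH !(tmap_pure, val_last_pure).
rewrite val_deltaI [LHS]Delta_coassoc /=.
rewrite -val_deltaI.
elim/tensor_ind: (deltaI y) => [|a b z IH]; first by rewrite !linear0.
rewrite !linearD /= IH; congr (_ + _).
rewrite !(tmap_pure, val_last_pure) /= -val_deltaI.
elim/tensor_ind: (deltaI b) => [|a' b' z' IH']; first by rewrite !(linear0, pure0r).
rewrite !linearD /= !pureDr !linearD /= IH'.
by rewrite !(tassoc_pure, val_last_pure).
Qed.

Lemma Delta_Ki2P : Delta (Ki ^+ 2 * P) = (Ki ^+ 2 * P) ⊗ (Ki ^+ 2 * P).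
Proof. by rewrite rmorphM rmorphXn /= Delta_Ki Delta_P !expr2 !pureM. Qed.

Lemma Delta_ApKiP :
  Delta (Ap * Ki * P) = (Ap * Ki * P) ⊗ 1 + (Ki ^+ 2 * P) ⊗ (Ap * Ki * P).
Proof.
rewrite !rmorphM /= Delta_Ap Delta_Ki Delta_P !mulrDl !pureM -(mulrA K) PKi.
by rewrite (mulrA K) KKi mul1r PP.
Qed.

(** The coefficient s^-1 - s collects the two cross terms: moving K and P past A_+ gives -s, moving
    K^-1 past A_+ gives s^-1. *)
Lemma Delta_Ap2P : Delta (Ap ^+ 2 * P) = (Ap ^+ 2 * P) ⊗ (K ^+ 2 * P)
  + (s^-1 - s) *: ((Ap * Ki * P) ⊗ (Ap * K)) + (Ki ^+ 2 * P) ⊗ (Ap ^+ 2 * P).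
Proof.
rewrite rmorphM rmorphXn /= Delta_Ap Delta_P !expr2 !(mulrDl, mulrDr) !pureM KPKP.
have -> : K * P * Ap * P = - (s *: (Ap * K)).
  by rewrite -(mulrA K) PAp mulrN mulNr mulrA -mulrA PP mulr1 KAp'.
have -> : Ap * (K * P) * P = Ap * K by rewrite -!mulrA PP mulr1.
rewrite (KiAp s0) -scalerAl pureNr pureZr pureZl expr2 scalerBl !addrA.
by rewrite (ACl (1*3*2*4)).
Qed.

Lemma deltaI_AmK : deltaI (iAmK s) = (Am * K) ⊗ iK2P s + 1 ⊗ iAmK s.
Proof.
by apply: val_last_inj; rewrite val_deltaI linearD /= !val_last_pure Delta_AmK.
Qed.

Lemma deltaI_ApK : deltaI (iApK s) = (Ap * K) ⊗ iK2P s + 1 ⊗ iApK s.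
Proof.
by apply: val_last_inj; rewrite val_deltaI linearD /= !val_last_pure Delta_ApK.
Qed.

Lemma deltaI_K2P : deltaI (iK2P s) = (K ^+ 2 * P) ⊗ iK2P s.
Proof. by apply: val_last_inj; rewrite val_deltaI val_last_pure Delta_K2P. Qed.

Lemma deltaI_Casimir : deltaI (iCasimir s) =
  (s^-1 *: (Ap * Ki * P)) ⊗ iAmK s + (- (Ki * Am * P)) ⊗ iApK s
  + (Cas + (s + s^-1)^-1 *: (Ki ^+ 2 * P)) ⊗ iK2P s
  + (Ki ^+ 2 * P) ⊗ iCasimir s.
Proof.
apply: val_last_inj; rewrite val_deltaI.
by rewrite !linearD /= !val_last_pure Delta_Casimir.
Qed.

Variable tau : {lrmorphism I -> tensor U I}.
Hypothesis tauP : is_coaction tau.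

(** Both sides are algebra morphisms in the argument, so the four generators suffice. *)
Lemma tau_coassoc : coassociative tau.
Proof.
have [tauM tauQ tauN tauG] := tauP.
apply: (coideal_morphism_ext (f := tmap (@Delta F s) (@idfun I) \o tau)
  (g := tassoc \o tmap (@idfun U) tau \o tau)) => /=.
- rewrite tauM !tmap_pure /= tauM tassoc_pure; congr (_ ⊗ _).
  exact: Delta_K2P.
- rewrite tauQ !linearD !linearZ /= !tmap_pure /= tauM tauQ tauN tauG.
  rewrite !(pureDr, pureNr, pureZr) !(linearD, linearN, linearZ) /= !tassoc_pure.
  rewrite Delta_Ki2P Delta_Ap2P Delta_ApKiP !(pureDl, pureZl) !scalerDr !scalerN !scalerA
    !addrA.
  rewrite -[X in _ = _ + X + _]scaleNr [RHS](ACl (1*5*7*2*6*3*8*4)) /=.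
  (* These are the coefficients of A_+ K^-1 P ⊗ A_+ K ⊗ A_- K: one side comes from the cross terms
     in the coproduct of A_+^2 P, the other from the A_- K part of tau(K^2 P). *)
  suff -> : - (s^-1 * (s - s^-1) * (q - q^-1)) = s^-1 * (q - q^-1) * (s^-1 - s).
    by [].
  by rewrite [in RHS]mulrAC -[in RHS]opprB mulrN mulNr.
- rewrite tauN !linearB !linearZ /= !tmap_pure /= tauM tauN.
  rewrite !(pureDr, pureNr, pureZr) !(linearD, linearN, linearZ) /= !tassoc_pure.
  rewrite rmorph1 Delta_ApK !(pureDl, pureNl) !(scalerDr, scalerN, scalerA).
  by rewrite opprD addrA addrAC.
- by rewrite tauG !tmap_pure /= tauG tassoc_pure rmorph1.
Qed.
End Comodule.

(** * The relations on three legs *)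

(* Up to scalar factors that clear the denominators (see the lemmas [eval_]
   below), [ncXM], [ncXQ], [ncXN], [ncXG] are the left and [ncM], [ncQ], [ncN],
   [ncG] the right factors of the four terms of [Delta_Casimir], while [ncT2],
   [ncT1], [ncT1'] and [ncQN] are the remaining coefficients of the coaction. *)
Section LegWords.
Variable l : nat.
Let Ap : letter := (l.+1, 0)%N.
Let B : letter := (l.+1, 1)%N.
Let K : letter := (l.+1, 2)%N.
Let Ki : letter := (l.+1, 3)%N.
Let P : letter := (l.+1, 4)%N.
Let S : letter := (0, 0)%N.
Let Si : letter := (0, 1)%N.
Definition ncG : ncpoly := [:: (-1, [:: S; Ap; B; P]); (-1, [:: Si; Ap; B; P]);
   (1, [:: Si; K; K; P]); (-1, [:: S; Ki; Ki; P])].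
Definition ncM : ncpoly := [:: (1, [:: B; K])].
Definition ncQ : ncpoly := [:: (1, [:: Ap; K])].
Definition ncN : ncpoly := [:: (1, [:: K; K; P])].
Definition ncXM : ncpoly := [:: (1, [:: Ap; Ki; P]); (1, [:: Si; Si; Ap; Ki; P])].
Definition ncXQ : ncpoly := [:: (-1, [:: S; Ki; B; P]); (-1, [:: Si; Ki; B; P])].
Definition ncXG : ncpoly := [:: (1, [:: Ki; Ki; P])].
Definition ncXN : ncpoly := ncG ++ [:: (1, [:: S; Ki; Ki; P]); (-1, [:: Si; Ki; Ki; P])].
Definition ncT2 : ncpoly := [:: (1, [:: Ap; Ap; P]); (1, [:: Si; Si; Ap; Ap; P])].
Definition ncT1 : ncpoly := [:: (1, [:: Si; Ap; Ki; P])].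
Definition ncT1' : ncpoly := [:: (1, [:: Ap; Ki; P]); (-1, [:: Si; Si; Ap; Ki; P])].
Definition ncQN : ncpoly := [:: (-1, [:: S; Ap; K]); (-1, [:: Si; Ap; K])].
End LegWords.

Definition ncneg (p : ncpoly) : ncpoly := [seq (- t.1, t.2) | t <- p].
Definition ncs : ncpoly := [:: (1, [:: (0%N,0%N)])].
Definition ncsi : ncpoly := [:: (1, [:: (0%N,1%N)])].
Definition ncsp : ncpoly := ncs ++ ncsi.

Local Notation "p ** q" := (ncmul (legs_rule 3) p q) (at level 40, left associativity).

Definition ncom : ncpoly := ncadd (ncs ** ncs) (ncneg (ncsi ** ncsi)).
Definition ncsum4 xM yM xQ yQ xN yN xG yG :=
  ncadd (xM ** yM) (ncadd (xQ ** yQ) (ncadd (xN ** yN) (xG ** yG))).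
(** The factor w is split between left and right as (s + s^-1)(s - s^-1) in the first product, lies
    wholly on the left in the next two, and on the right in the last. *)
Definition ncG2 l k := ncsum4 (ncXM l) (ncM k) (ncXQ l) (ncQ k) (ncXN l) (ncN k) (ncXG l)
  (ncG k).
Definition ncD12 := ncG2 0 1.
Definition ncD23 := ncG2 1 2.
(** The inner [ncsum4] is tau(A_+ K) without extra factor: its coefficients s^-1 w absorb the
    scalings of [ncM] and [ncG]. *)
Definition ncD13 := ncsum4 (ncXM 0) (ncN 1 ** ncM 2)
  (ncXQ 0) (ncsum4 (ncT2 1) (ncM 2) (ncXG 1) (ncQ 2) (ncT1' 1) (ncN 2) (ncT1 1) (ncG 2))
  (ncXN 0) (ncadd (ncN 2) (ncQN 1 ** ncM 2)) (ncXG 0) (ncG 2).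
Definition ncD123 := ncsum4 (ncXM 0) (ncadd (ncM 1 ** ncN 2) (ncM 2))
  (ncXQ 0) (ncadd (ncQ 1 ** ncN 2) (ncQ 2))
  (ncXN 0) (ncN 1 ** ncN 2)
  (ncXG 0) ncD23.
Definition ncqa x y := ncadd (ncs ** (x ** y)) (ncsi ** (y ** x)).
(** The relation multiplied by w^2. Every argument carries one factor w, hence the additional [ncom]
    in front of the linear term [c]. *)
Definition ncBI a b c t1 t2 t3 t123 :=
  nczero (ncadd (ncqa a b)
    (ncneg (ncadd (ncom ** c) (ncsp ** ncadd (t1 ** t123) (t2 ** t3))))).

Lemma ncBI1 : ncBI ncD12 ncD23 ncD13 (ncG 1) (ncG 0) (ncG 2) ncD123.
Proof. by vm_compute. Qed.

Lemma ncBI2 : ncBI ncD23 ncD13 ncD12 (ncG 2) (ncG 1) (ncG 0) ncD123.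
Proof. by vm_compute. Qed.

Lemma ncBI3 : ncBI ncD13 ncD12 ncD23 (ncG 0) (ncG 2) (ncG 1) ncD123.
Proof. by vm_compute. Qed.

Section ThreeLegs.
Variables (F : fieldType) (s : F).
Hypotheses (s0 : s != 0) (sp0 : s + s^-1 != 0) (sm0 : s - s^-1 != 0).
Local Notation q := (s ^+ 2).
Local Notation U := (osp s).
Local Notation Ap := (Ap s).
Local Notation Am := (Am s).
Local Notation K := (K s).
Local Notation Ki := (Ki s).
Local Notation P := (P s).
Local Notation Cas := (Casimir s).
Local Notation w := (q - q^-1).

Variables (W : algType F) (leg : nat -> {lrmorphism U -> W}).
Hypothesis legC : forall l k a b, (l < k < 3)%N -> leg k b * leg l a = leg l a * leg k b.

(** The shape of (1 ⊗ f) applied to the coproduct of the Casimir, the arguments being the images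
    under f of A_- K, A_+ K, K^2 P and the Casimir. Taking for f the inclusion, the coaction or the
    coproduct yields the elements of {1,2}, {1,3} and {1,2,3}. *)
Definition cas_sum (zM zQ zN zG : W) : W :=
  leg 0 (s^-1 *: (Ap * Ki * P)) * zM + leg 0 (- (Ki * Am * P)) * zQ
  + leg 0 (Cas + (s + s^-1)^-1 *: (Ki ^+ 2 * P)) * zN + leg 0 (Ki ^+ 2 * P) * zG.
Definition leg12 : W :=
  cas_sum (leg 1 (Am * K)) (leg 1 (Ap * K)) (leg 1 (K ^+ 2 * P)) (leg 1 Cas).
Definition leg23 : W :=
  leg 1 (s^-1 *: (Ap * Ki * P)) * leg 2 (Am * K) + leg 1 (- (Ki * Am * P)) * leg 2 (Ap * K)
  + leg 1 (Cas + (s + s^-1)^-1 *: (Ki ^+ 2 * P)) * leg 2 (K ^+ 2 * P)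
  + leg 1 (Ki ^+ 2 * P) * leg 2 Cas.
Definition leg13 : W :=
  cas_sum (leg 1 (K ^+ 2 * P) * leg 2 (Am * K))
    (leg 1 (Ki ^+ 2 * P) * leg 2 (Ap * K)
     + (s^-1 * w) *: (leg 1 (Ap ^+ 2 * P) * leg 2 (Am * K))
     + (s^-1 * (s - s^-1)) *: (leg 1 (Ap * Ki * P) * leg 2 (K ^+ 2 * P))
     + (s^-1 * w) *: (leg 1 (Ap * Ki * P) * leg 2 Cas))
    (leg 2 (K ^+ 2 * P) - w *: (leg 1 (Ap * K) * leg 2 (Am * K))) (leg 2 Cas).
Definition leg123 : W :=
  cas_sum (leg 1 (Am * K) * leg 2 (K ^+ 2 * P) + leg 2 (Am * K))
    (leg 1 (Ap * K) * leg 2 (K ^+ 2 * P) + leg 2 (Ap * K))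
    (leg 1 (K ^+ 2 * P) * leg 2 (K ^+ 2 * P)) leg23.

Local Notation E := (nceval (legs_letter leg)).

Lemma eval_mul p p' : E (p ** p') = E p * E p'.
Proof. have H := legs_eval_mul s0 sm0 legC p p'. exact H. Qed.

Let evE := (big_cons, big_nil, mulr1, addr0, mulr1z, mulrN1z, mulr_algl).
Ltac ev := rewrite /nceval !evE /weval !evE /= ?mulr_algl ?(mulr1, addr0, mulr1z, mulrN1z).

Let legZ l c x : leg l (c *: x) = c *: leg l x. Proof. exact: linearZ. Qed.
Let legM l x y : leg l (x * y) = leg l x * leg l y. Proof. exact: rmorphM. Qed.

Lemma eval_G l : E (ncG l) = w *: leg l Cas.
Proof.
ev; rewrite CasimirE linearD linearN /= !legZ linearB /= !legZ !legM.
rewrite scalerDr scalerA mulfV ?omega_neq0 // scale1r.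
rewrite -!scalerAl -!scalerAr !scalerA -!mulrA !addrA -opprD -scalerDl -mulrDl.
by rewrite scalerN -omegaE.
Qed.

Lemma eval_M l : E (ncM l) = (s - s^-1) *: leg l (Am * K).
Proof. by ev; rewrite legZ legM scalerAl. Qed.

Lemma eval_Q l : E (ncQ l) = leg l (Ap * K).
Proof. by ev; rewrite legM. Qed.

Lemma eval_N l : E (ncN l) = leg l (K ^+ 2 * P).
Proof. by ev; rewrite !legM mulrA. Qed.

Lemma eval_XM l : E (ncXM l) = (s + s^-1) *: leg l (s^-1 *: (Ap * Ki * P)).
Proof.
by ev; rewrite legZ !legM !scalerA mulrDl mulfV // scalerDl scale1r !mulrA.
Qed.

Lemma eval_XQ l : E (ncXQ l) = w *: leg l (- (Ki * Am * P)).
Proof.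
ev; rewrite linearN /= legZ !legM -scalerAl -scalerAr !scalerA -mulrA -opprD -scalerDl
  -mulrDl.
by rewrite scalerN omegaE.
Qed.

Lemma eval_XG l : E (ncXG l) = leg l (Ki ^+ 2 * P).
Proof. by ev; rewrite !legM mulrA. Qed.

Lemma eval_XN l : E (ncXN l) = w *: leg l (Cas + (s + s^-1)^-1 *: (Ki ^+ 2 * P)).
Proof.
rewrite /ncXN nceval_cat eval_G linearD /= legZ scalerDr; congr (_ + _).
by ev; rewrite !legM !scalerA omegaE mulrC mulKf // scalerBl !mulrA.
Qed.

Lemma eval_T2 l : E (ncT2 l) = (s^-1 * (s + s^-1)) *: leg l (Ap ^+ 2 * P).
Proof. by ev; rewrite !legM !scalerA mulrDr mulVf // scalerDl scale1r mulrA. Qed.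

Lemma eval_T1 l : E (ncT1 l) = s^-1 *: leg l (Ap * Ki * P).
Proof. by ev; rewrite !legM mulrA. Qed.

Lemma eval_T1' l : E (ncT1' l) = (s^-1 * (s - s^-1)) *: leg l (Ap * Ki * P).
Proof. by ev; rewrite !legM !scalerA mulrBr mulVf // scalerBl scale1r !mulrA. Qed.

Lemma eval_QN l : E (ncQN l) = - ((s + s^-1) *: leg l (Ap * K)).
Proof. by ev; rewrite !legM scalerDl opprD. Qed.

Lemma eval_s : E ncs = s%:A.
Proof. by ev. Qed.

Lemma eval_si : E ncsi = s^-1%:A.
Proof. by ev. Qed.

Lemma eval_sp : E ncsp = (s + s^-1)%:A.
Proof. by rewrite nceval_cat eval_s eval_si -scalerDl. Qed.

Lemma eval_neg p : E (ncneg p) = - E p.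
Proof. by rewrite /nceval big_map -sumrN; apply: eq_bigr => t _; rewrite mulrNz. Qed.

Lemma eval_om : E ncom = w%:A.
Proof.
rewrite nceval_add eval_neg !eval_mul eval_s eval_si !mulr_algl !scalerA -scalerBl.
by rewrite -expr2 -invfM.
Qed.

Lemma eval_sum4 zM zQ zN zG pM pQ pN pG :
  E pM = (s - s^-1) *: zM -> E pQ = zQ -> E pN = zN -> E pG = w *: zG ->
  E (ncsum4 (ncXM 0) pM (ncXQ 0) pQ (ncXN 0) pN (ncXG 0) pG) = w *: cas_sum zM zQ zN zG.
Proof.
move=> EM EQ EN EG; rewrite /ncsum4 !(eval_mul, nceval_add) EM EQ EN EG eval_XM eval_XQ
  eval_XN eval_XG.
rewrite /cas_sum !scalerDr -!scalerAl -!scalerAr scalerA -omegaE.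
by rewrite !addrA.
Qed.

Lemma eval_D12 : E ncD12 = w *: leg12.
Proof. by apply: eval_sum4; [exact: eval_M|exact: eval_Q|exact: eval_N|exact: eval_G]. Qed.

Lemma eval_D23 : E ncD23 = w *: leg23.
Proof.
rewrite /ncD23 /ncG2 /ncsum4 !(eval_mul, nceval_add) eval_XM eval_XQ eval_XN eval_XG
  eval_M eval_Q eval_N eval_G.
rewrite /leg23 !scalerDr -!scalerAl -!scalerAr scalerA -omegaE.
by rewrite !addrA.
Qed.

Lemma eval_D13 : E ncD13 = w *: leg13.
Proof.
apply: eval_sum4.
- by rewrite eval_mul eval_M eval_N scalerAr.
- rewrite /ncsum4 !(eval_mul, nceval_add) eval_M eval_N eval_Q eval_T2 eval_T1 eval_T1'
  eval_XG eval_G.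
  rewrite -!scalerAl -!scalerAr !scalerA.
  rewrite -[X in X *: _ + _](mulrA s^-1) -omegaE !addrA.
  by rewrite (ACl (2*1*3*4)).
- rewrite nceval_add eval_mul eval_N eval_M eval_QN mulNr -scalerAl -scalerAr scalerA
  -omegaE.
  by [].
- exact: eval_G.
Qed.

Lemma eval_D123 : E ncD123 = w *: leg123.
Proof.
apply: eval_sum4.
- by rewrite nceval_add eval_mul eval_M eval_M eval_N scalerDr scalerAl.
- by rewrite nceval_add eval_mul eval_Q eval_Q eval_N.
- by rewrite eval_mul !eval_N.
- exact: eval_D23.
Qed.

Lemma eval_qa p p' x y : E p = w *: x -> E p' = w *: y ->
  E (ncqa p p') = w ^+ 2 *: qanticomm s x y.
Proof.
move=> px py; rewrite nceval_add !eval_mul px py eval_s eval_si !mulr_algl /qanticomm.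
rewrite -!scalerAl -!scalerAr !scalerA scalerDr !scalerA expr2.
by congr (_ *: _ + _ *: _); ring.
Qed.

(** The vanishing polynomial evaluates to w^2 times the difference of the two sides, and w^2 is an
    invertible scalar. *)
Lemma BI_legs a b c t1 t2 t3 t123 xa xb xc x1 x2 x3 x123 :
  E a = w *: xa -> E b = w *: xb -> E c = w *: xc ->
  E t1 = w *: x1 -> E t2 = w *: x2 -> E t3 = w *: x3 -> E t123 = w *: x123 ->
  ncBI a b c t1 t2 t3 t123 ->
  qanticomm s xa xb = xc + (s + s^-1) *: (x1 * x123 + x2 * x3).
Proof.
move=> Ea Eb Ec E1 E2 E3 E123 /(nczeroP (legs_letter leg)).
rewrite nceval_add eval_neg => /eqP; rewrite subr_eq0 => /eqP.
rewrite (eval_qa Ea Eb) !(eval_om, eval_mul, nceval_add) eval_sp Ec E1 E2 E3 E123.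
rewrite !mulr_algl -!scalerAl -!scalerAr !scalerA -scalerDr scalerA.
rewrite [(s + _) * _]mulrC -(scalerA (w * w)) -scalerDr -expr2.
by apply: scalerI; rewrite expf_neq0 // omega_neq0.
Qed.

Lemma BI_leg1 : qanticomm s leg12 leg23 =
  leg13 + (s + s^-1) *: (leg 1 Cas * leg123 + leg 0 Cas * leg 2 Cas).
Proof. exact: BI_legs eval_D12 eval_D23 eval_D13 (eval_G 1) (eval_G 0) (eval_G 2)
  eval_D123 ncBI1. Qed.

Lemma BI_leg2 : qanticomm s leg23 leg13 =
  leg12 + (s + s^-1) *: (leg 2 Cas * leg123 + leg 1 Cas * leg 0 Cas).
Proof. exact: BI_legs eval_D23 eval_D13 eval_D12 (eval_G 2) (eval_G 1) (eval_G 0)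
  eval_D123 ncBI2. Qed.

Lemma BI_leg3 : qanticomm s leg13 leg12 =
  leg23 + (s + s^-1) *: (leg 0 Cas * leg123 + leg 2 Cas * leg 1 Cas).
Proof. exact: BI_legs eval_D13 eval_D12 eval_D23 (eval_G 0) (eval_G 2) (eval_G 1)
  eval_D123 ncBI3. Qed.
End ThreeLegs.

(** * The relations in U ⊗ U ⊗ I for the subsets of {1, 2, 3} *)

Section BaseCase.
Variables (F : fieldType) (s : F).
Hypotheses (s0 : s != 0) (sp0 : s + s^-1 != 0) (sm0 : s - s^-1 != 0).
Local Notation q := (s ^+ 2).
Local Notation U := (osp s).
Local Notation I := (coideal s).
Local Notation Cas := (Casimir s).
Local Notation w := (q - q^-1).

Variable deltaI : {lrmorphism I -> tensor U I}.
Hypothesis val_deltaI : forall x, val_last (deltaI x) = Delta (val x).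
Variable tau : {lrmorphism I -> tensor U I}.
Hypothesis tauP : is_coaction tau.

Definition leg3 (l : nat) : {lrmorphism U -> tensor (tensor U U) U} :=
  match l with
  | 0 => (@inl_tensor F (tensor U U) U \o @inl_tensor F U U)
  | 1 => (@inl_tensor F (tensor U U) U \o @inr_tensor F U U)
  | _ => @inr_tensor F (tensor U U) U
  end%N.

Lemma leg3C l k a b : (l < k < 3)%N -> leg3 k b * leg3 l a = leg3 l a * leg3 k b.
Proof.
case/andP; case: l k => [|[|[|l]]] [|[|[|k]]] // _ _;
  by rewrite /= /inl_tensor /inr_tensor /= !pureM ?(mul1r, mulr1).
Qed.

(** The last leg is kept in the coideal because further coactions will be applied to it. *)
Definition gamma12 : tensor (tensor U U) I := Delta Cas ⊗ 1.
Definition gamma23 : tensor (tensor U U) I := tassoc (1 ⊗ deltaI (iCasimir s)).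
Definition gamma13 : tensor (tensor U U) I :=
  tassoc (tmap (@idfun U) tau (deltaI (iCasimir s))).
Definition gamma123 : tensor (tensor U U) I :=
  tassoc (tmap (@idfun U) deltaI (deltaI (iCasimir s))).
Definition gamma1 : tensor (tensor U U) I := (Cas ⊗ 1) ⊗ 1.
Definition gamma2 : tensor (tensor U U) I := (1 ⊗ Cas) ⊗ 1.
Definition gamma3 : tensor (tensor U U) I := (1 ⊗ 1) ⊗ iCasimir s.

(** Isolates the last two legs of an iterated coaction; the first leg splits off as a left factor by
    [last2_leg]. *)
Definition last2 (t : tensor U I) : tensor (tensor U U) U := val_last (tassoc (1 ⊗ t)).

Lemma last2_linear : linear last2.
Proof. by move=> c x y; rewrite /last2 pure_linr !linearP. Qed.
HB.instance Definition _ := GRing.isLinear.Build F (tensor U I)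
  (tensor (tensor U U) U) _ last2 last2_linear.

Lemma last2_pure b y : last2 (b ⊗ y) = leg3 1 b * leg3 2 (\val y).
Proof.
by rewrite /last2 tassoc_pure val_last_pure /= /inl_tensor /inr_tensor pureM mulr1 mul1r.
Qed.

Lemma last2_1 y : last2 (1 ⊗ y) = leg3 2 (\val y).
Proof. by rewrite last2_pure rmorph1 mul1r. Qed.

Lemma last2_leg a t : val_last (tassoc (a ⊗ t)) = leg3 0 a * last2 t.
Proof.
have -> : a ⊗ t = (a ⊗ 1) * (1 ⊗ t) by rewrite pureM mulr1 mul1r.
by rewrite !rmorphM /= tassoc_pure val_last_pure.
Qed.

Lemma pure_leg a b : (a ⊗ b) ⊗ 1 = leg3 0 a * leg3 1 b.
Proof. by rewrite /= /inl_tensor /inr_tensor !pureM !(mulr1, mul1r). Qed.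

Lemma val_gamma12 : val_last gamma12 = leg12 leg3.
Proof.
by rewrite val_last_pure Delta_Casimir // /leg12 /cas_sum -!pure_leg -!pureDl.
Qed.

Lemma last2_tau_K2P : last2 (tau (iK2P s)) =
  leg3 2 (K s ^+ 2 * P s) - w *: (leg3 1 (Ap s * K s) * leg3 2 (Am s * K s)).
Proof. by have [_ _ -> _] := tauP; rewrite linearB linearZ /= last2_1 last2_pure. Qed.

Lemma last2_tau_ApK : last2 (tau (iApK s)) =
  leg3 1 (Ki s ^+ 2 * P s) * leg3 2 (Ap s * K s)
  + (s^-1 * w) *: (leg3 1 (Ap s ^+ 2 * P s) * leg3 2 (Am s * K s))
  + (s^-1 * (s - s^-1)) *: (leg3 1 (Ap s * Ki s * P s) * leg3 2 (K s ^+ 2 * P s))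
  + (s^-1 * w) *: (leg3 1 (Ap s * Ki s * P s) * leg3 2 Cas).
Proof. by have [_ -> _ _] := tauP; rewrite !linearD !linearZ /= !last2_pure. Qed.

Lemma last2_tau_Casimir : last2 (tau (iCasimir s)) = leg3 2 Cas.
Proof. by have [_ _ _ ->] := tauP; rewrite last2_1. Qed.

Lemma last2_deltaI_AmK : last2 (deltaI (iAmK s)) =
  leg3 1 (Am s * K s) * leg3 2 (K s ^+ 2 * P s) + leg3 2 (Am s * K s).
Proof. by rewrite deltaI_AmK // linearD /= last2_pure last2_1. Qed.

Lemma last2_deltaI_ApK : last2 (deltaI (iApK s)) =
  leg3 1 (Ap s * K s) * leg3 2 (K s ^+ 2 * P s) + leg3 2 (Ap s * K s).
Proof. by rewrite deltaI_ApK // linearD /= last2_pure last2_1. Qed.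

Lemma last2_deltaI_Casimir : last2 (deltaI (iCasimir s)) = leg23 leg3.
Proof. by rewrite (deltaI_Casimir sm0 val_deltaI) !linearD /= !last2_pure. Qed.

Lemma val_gamma23 : val_last gamma23 = leg23 leg3.
Proof. exact: last2_deltaI_Casimir. Qed.

Lemma val_gamma13 : val_last gamma13 = leg13 leg3.
Proof.
have [tauM _ _ _] := tauP.
rewrite /gamma13 (deltaI_Casimir sm0 val_deltaI) !linearD /= !tmap_pure !last2_leg /=.
by rewrite last2_tau_K2P last2_tau_Casimir last2_tau_ApK tauM last2_pure.
Qed.

Lemma val_gamma123 : val_last gamma123 = leg123 leg3.
Proof.
rewrite /gamma123 (deltaI_Casimir sm0 val_deltaI) !linearD /= !tmap_pure !last2_leg /=.
rewrite last2_deltaI_AmK last2_deltaI_ApK last2_deltaI_Casimir deltaI_K2P //.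
by rewrite last2_pure.
Qed.

Lemma val_gamma1 : val_last gamma1 = leg3 0 Cas.
Proof. exact: val_last_pure. Qed.

Lemma val_gamma2 : val_last gamma2 = leg3 1 Cas.
Proof. exact: val_last_pure. Qed.

Lemma val_gamma3 : val_last gamma3 = leg3 2 Cas.
Proof. exact: val_last_pure. Qed.

Lemma val_qanticomm x y :
  val_last (qanticomm s x y) = qanticomm s (val_last x) (@val_last F s (tensor U U) y).
Proof. by rewrite /qanticomm linearD !linearZ /= !rmorphM. Qed.

Lemma gamma_rel1 : qanticomm s gamma12 gamma23 =
  gamma13 + (s + s^-1) *: (gamma2 * gamma123 + gamma1 * gamma3).
Proof.
apply: val_last_inj; rewrite val_qanticomm linearD linearZ linearD /= !rmorphM /=.
rewrite val_gamma12 val_gamma23 val_gamma13 val_gamma123 val_gamma1 val_gamma2 val_gamma3.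
exact: BI_leg1 leg3C.
Qed.

Lemma gamma_rel2 : qanticomm s gamma23 gamma13 =
  gamma12 + (s + s^-1) *: (gamma3 * gamma123 + gamma2 * gamma1).
Proof.
apply: val_last_inj; rewrite val_qanticomm linearD linearZ linearD /= !rmorphM /=.
rewrite val_gamma12 val_gamma23 val_gamma13 val_gamma123 val_gamma1 val_gamma2 val_gamma3.
exact: BI_leg2 leg3C.
Qed.

Lemma gamma_rel3 : qanticomm s gamma13 gamma12 =
  gamma23 + (s + s^-1) *: (gamma1 * gamma123 + gamma3 * gamma2).
Proof.
apply: val_last_inj; rewrite val_qanticomm linearD linearZ linearD /= !rmorphM /=.
rewrite val_gamma12 val_gamma23 val_gamma13 val_gamma123 val_gamma1 val_gamma2 val_gamma3.
exact: BI_leg3 leg3C.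
Qed.
End BaseCase.

(** * Iterated coactions *)

Section IteratedCoaction.
Variables (F : fieldType) (s : F).
Local Notation U := (osp s).
Local Notation T := (tpow s).

Lemma tmap_tmap_assoc (A B C A' B' : algType F) (f : {linear A -> A'})
    (g : {linear B -> B'}) (z : tensor A (tensor B C)) :
  tmap (tmap f g) (@idfun C) (tassoc z) = tassoc (tmap f (tmap g (@idfun C)) z).
Proof.
elim/tensor_ind: z => [|a t z IH]; first by rewrite !linear0.
rewrite !linearD /= IH tmap_pure; congr (_ + _).
elim/tensor_ind: t => [|b c t IHt]; first by rewrite !(linear0, pure0r).
by rewrite !(pureDr, linearD) /= IHt !(tmap_pure, tassoc_pure) /= tmap_pure.
Qed.

Section Coaction.
Variables (B : algType F) (c : {lrmorphism B -> tensor U B}).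

(** For [B := U] the source is the tensor power [T m.+1] itself, so iterated coproducts and
    coactions share one construction. *)
Definition coact_last m : tensor (T m) B -> tensor (T m.+1) B :=
  tassoc \o tmap (@idfun (T m)) c.
HB.instance Definition _ m := GRing.Linear.on (@coact_last m).
HB.instance Definition _ m := GRing.RMorphism.on (@coact_last m).

Lemma coact_last_pure m a b : coact_last (m := m) (a ⊗ b) = tassoc (a ⊗ c b).
Proof. by rewrite /coact_last /= tmap_pure. Qed.

Lemma coact_last1 m (y : T m) : coact_last (y ⊗ 1) = (y ⊗ 1) ⊗ 1.
Proof. by rewrite coact_last_pure rmorph1 tassoc_pure. Qed.

Fixpoint iter_coact k m : tensor (T m) B -> tensor (T (k + m)) B :=
  if k is k'.+1 return tensor (T m) B -> tensor (T (k + m)) B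
  then @coact_last (k' + m) \o @iter_coact k' m else idfun.

Lemma iter_coact_linear k m : linear (@iter_coact k m).
Proof. by elim: k => [|k IH] //= a x y; rewrite /= IH linearP. Qed.

Lemma iter_coact_monoid k m : monoid_morphism (@iter_coact k m).
Proof.
elim: k => [|k [IH1 IHM]] //=; split=> [|x y]; first by rewrite /= IH1 rmorph1.
by rewrite /= IHM rmorphM.
Qed.
HB.instance Definition _ k m := GRing.isLinear.Build F (tensor (T m) B)
  (tensor (T (k + m)) B) _ (@iter_coact k m) (@iter_coact_linear k m).
HB.instance Definition _ k m := GRing.isMonoidMorphism.Build (tensor (T m) B)
  (tensor (T (k + m)) B) (@iter_coact k m) (@iter_coact_monoid k m).

Lemma iter_coact1 k m (y : T m) : iter_coact k (y ⊗ 1) = rpad k y ⊗ 1.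
Proof. by elim: k => [|k IH] //=; rewrite IH coact_last1. Qed.

Lemma iter_coactD k l m x :
  Tagged (fun n => tensor (T n) B : Type) (iter_coact (k + l) (m := m) x)
  = Tagged (fun n => tensor (T n) B : Type) (iter_coact k (iter_coact l x)).
Proof.
elim: k => [|k IH] //; rewrite /=.
exact: (congr1 (fun y : {n & tensor (T n) B} => Tagged (fun n => tensor (T n) B : Type)
  (coact_last (tagged y))) IH).
Qed.
End Coaction.

Lemma coact_last_inr (B : algType F) (c : {lrmorphism B -> tensor U B}) m y :
  coact_last c (m := m) (1 ⊗ y) = tmap (@inr_tensor F (T m) U) (@idfun B) (c y).
Proof.
rewrite coact_last_pure; elim/tensor_ind: (c y) => [|u b t IH]; first by rewrite pure0r
  !linear0.
by rewrite pureDr !linearD /= IH tassoc_pure tmap_pure.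
Qed.

Local Notation D := (@Delta F s).

Definition pure_assoc (A B C : algType F) (a : A) (t : tensor B C) : tensor (tensor A B)
  C :=
  tassoc (a ⊗ t).
Lemma pure_assoc_linear (A B C : algType F) (a : A) : linear (@pure_assoc A B C a).
Proof. by move=> x t u; rewrite /pure_assoc pure_linr linearP. Qed.
HB.instance Definition _ (A B C : algType F) (a : A) := GRing.isLinear.Build F
  (tensor B C) (tensor (tensor A B) C) _ (@pure_assoc A B C a) (pure_assoc_linear a).

(** On a pure tensor this is the comodule axiom at the last factor, the front being carried along.
    It trades a coproduct on the next-to-last factor for one more coaction on the last, which serves
    both for gaps and for spreading a leg over several positions. *)
Lemma tmap_coact_last (B : algType F) (c : {lrmorphism B -> tensor U B}) m (z : tensor (T
  m) B) :
  coassociative c ->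
  tmap (@coact_last U D m) (@idfun B) (coact_last c z) = coact_last c (coact_last c z).
Proof.
move=> cP; elim/tensor_ind: z => [|a y z IH]; first by rewrite !linear0.
rewrite !linearD /= IH !coact_last_pure; congr (_ + _).
pose G : {linear tensor (tensor U U) B -> tensor (T m.+2) B} :=
  tmap (@pure_assoc (T m) U U a) (@idfun B).
transitivity (G (tmap D (@idfun B) (c y))).
  elim/tensor_ind: (c y) => [|u b t IHt]; first by rewrite pure0r !linear0.
  by rewrite pureDr !linearD /= IHt tassoc_pure !tmap_pure /= coact_last_pure.
rewrite cP.
elim/tensor_ind: (c y) => [|u b t IHt]; first by rewrite pure0r !linear0.
rewrite pureDr !linearD /= IHt tassoc_pure !tmap_pure coact_last_pure /=; congr (_ + _).
elim/tensor_ind: (c b) => [|u' b' t' IHt']; first by rewrite !(pure0r, linear0).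
by rewrite !(pureDr, linearD) /= IHt' !tassoc_pure tmap_pure /= /pure_assoc tassoc_pure.
Qed.

Lemma tmap_comp (A A' A'' B : algType F) (f : {linear A -> A'}) (g : {linear A' -> A''})
    (h : {linear A -> A''}) (z : tensor A B) :
  (forall a, g (f a) = h a) -> tmap g (@idfun B) (tmap f (@idfun B) z) = tmap h (@idfun
    B) z.
Proof.
move=> gf; elim/tensor_ind: z => [|a b z IH]; first by rewrite !linear0.
by rewrite !linearD /= IH !tmap_pure /= gf.
Qed.

Lemma tmap_id (A B : algType F) (z : tensor A B) : tmap (@idfun A) (@idfun B) z = z.
Proof.
elim/tensor_ind: z => [|a b z IH]; first by rewrite !linear0.
by rewrite linearD /= IH tmap_pure.
Qed.

Lemma tmap_iter_coact (B : algType F) (c : {lrmorphism B -> tensor U B}) k m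
    (z : tensor (T m) B) : coassociative c ->
  tmap (@iter_coact U D k m) (@idfun B) (coact_last c z) = coact_last c (iter_coact c k z).
Proof.
move=> cP; elim: k => [|k IH]; first exact: tmap_id.
rewrite /= -(tmap_coact_last _ cP) -IH.
rewrite [RHS](tmap_comp (h := iter_coact D k.+1 (m := m))) //.
Qed.

Variable deltaI : {lrmorphism coideal s -> tensor U (coideal s)}.
Hypothesis deltaIP : coassociative deltaI.
Variable tau : {lrmorphism coideal s -> tensor U (coideal s)}.
Hypotheses (tauP : coassociative tau) (tau_Cas : tau (iCasimir s) = 1 ⊗ iCasimir s).
Local Notation I := (coideal s).
Local Notation Cas := (Casimir s).

Section Embedding.
Variables i k1 k2 g : nat.

(* [embed1] spreads a leg over the positions i, ..., i + k1, [embed2] the second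
   leg over the next k2 + 1 positions, and [embed3] skips g more positions. *)
Definition embed1 : U -> T (k1 + i).+1 := @iter_coact U D k1 i \o @inr_tensor F (T i) U.
HB.instance Definition _ := GRing.Linear.on embed1.
HB.instance Definition _ := GRing.RMorphism.on embed1.
Definition embed2 : tensor U U -> T (k2 + (k1 + i).+1).+1 :=
  @iter_coact U D k2 (k1 + i).+1 \o tmap embed1 (@idfun U).
HB.instance Definition _ := GRing.Linear.on embed2.
HB.instance Definition _ := GRing.RMorphism.on embed2.
Local Notation M := (k2 + (k1 + i).+1).+1.
Definition embed3 : tensor (tensor U U) I -> tensor (T (g + M)) I :=
  @iter_coact I tau g M \o tmap embed2 (@idfun I).
HB.instance Definition _ := GRing.Linear.on embed3.
HB.instance Definition _ := GRing.RMorphism.on embed3.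

Lemma iter_tau_Casimir k m : iter_coact tau k ((1 : T m) ⊗ iCasimir s) = 1 ⊗ iCasimir s.
Proof. by elim: k => [|k IH] //=; rewrite IH coact_last_pure tau_Cas tassoc_pure. Qed.

Lemma embed2_pure a b : embed2 (a ⊗ b) = iter_coact D k2 (embed1 a ⊗ b).
Proof. by rewrite /embed2 /= tmap_pure. Qed.

(** Coassociativity: spreading the legs of the coproduct of u over k1 + 1 and k2 + 1 positions is
    the iterated coproduct of u over all of them. *)
Lemma embed2_Delta u : embed2 (D u)
  = iter_coact D k2 (coact_last D (iter_coact D k1 ((1 : T i) ⊗ u))).
Proof.
rewrite /embed2 /= -(tmap_iter_coact _ _ (@Delta_coassoc F s)) coact_last_inr.
by rewrite (tmap_comp (h := embed1)).
Qed.

Lemma embed_gamma1 :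
  embed3 (gamma1 s) = rpad g (rpad k2.+1 (iter_coact D k1 ((1 : T i) ⊗ Cas) : T (k1 +
    i).+1)) ⊗ 1.
Proof. by rewrite /embed3 /gamma1 /= tmap_pure iter_coact1 /= embed2_pure iter_coact1. Qed.

Lemma embed_gamma2 :
  embed3 (gamma2 s) = rpad g (iter_coact D k2 ((1 : T (k1 + i).+1) ⊗ Cas) : T M) ⊗ 1.
Proof.
by rewrite /embed3 /gamma2 /= tmap_pure iter_coact1 /= embed2_pure [embed1 1]rmorph1.
Qed.

Lemma embed_gamma3 : embed3 (gamma3 s) = 1 ⊗ iCasimir s.
Proof. by rewrite /embed3 /gamma3 /= tmap_pure /= [embed2 _]rmorph1 iter_tau_Casimir. Qed.

Lemma embed_gamma12 : embed3 (gamma12 s) =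
  rpad g (iter_coact D k2 (coact_last D (iter_coact D k1 ((1 : T i) ⊗ Cas))) : T M) ⊗ 1.
Proof. by rewrite /embed3 /gamma12 /= tmap_pure iter_coact1 /= [embed2 _]embed2_Delta. Qed.

(** The comodule axiom moves the second coaction to a coproduct on the left; both sides then become
    a single map on the left factor of [deltaI (iCasimir s)]. *)
Lemma embed_gamma123 : embed3 (gamma123 deltaI) =
  iter_coact tau g (coact_last deltaI (iter_coact deltaI k2
    (coact_last deltaI (iter_coact deltaI k1 ((1 : T i) ⊗ iCasimir s))))).
Proof.
rewrite /embed3 /gamma123 /= -deltaIP; congr iter_coact.
rewrite -[in RHS](tmap_iter_coact _ _ deltaIP) -(tmap_coact_last _ deltaIP).
rewrite -(tmap_iter_coact _ _ deltaIP) coact_last_inr.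
rewrite [LHS](tmap_comp (h := embed2 \o D)) //.
rewrite (tmap_comp (h := embed1)) // (tmap_comp (h := coact_last D (m := _) \o embed1)) //.
by rewrite (tmap_comp (h := embed2 \o D)) // => u; rewrite /= embed2_Delta.
Qed.

Lemma embed_gamma23 : embed3 (gamma23 deltaI) =
  iter_coact tau g (coact_last deltaI (iter_coact deltaI k2 ((1 : T (k1 + i).+1) ⊗
    iCasimir s))).
Proof.
rewrite /embed3 /gamma23 /=; congr iter_coact.
rewrite -(tmap_iter_coact _ _ deltaIP) coact_last_inr.
have -> : tassoc (1 ⊗ deltaI (iCasimir s)) = tmap (@inr_tensor F U U) (@idfun I) (deltaI
  (iCasimir s)).
  elim/tensor_ind: (deltaI _) => [|u b t IH]; first by rewrite pure0r !linear0.
  by rewrite pureDr !linearD /= IH tassoc_pure tmap_pure.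
rewrite [LHS](tmap_comp (h := @iter_coact U D k2 (k1 + i).+1 \o @inr_tensor F _ U)).
  by rewrite [RHS](tmap_comp (h := @iter_coact U D k2 (k1 + i).+1 \o @inr_tensor F _ U)).
by move=> u; rewrite /= [embed2 _]embed2_pure [embed1 1]rmorph1.
Qed.

(** The k2 coproducts spreading the middle leg become k2 further applications of [tau]: the zone A2
    turns into a gap of length k2 + 1. *)
Lemma embed_gamma13 : embed3 (gamma13 deltaI tau) =
  iter_coact tau g (iter_coact tau k2.+1 (coact_last deltaI (iter_coact deltaI k1 ((1 : T
    i) ⊗ iCasimir s)))).
Proof.
rewrite /embed3 /gamma13 /=; congr iter_coact.
rewrite -(tmap_iter_coact _ _ tauP) -(tmap_iter_coact _ _ deltaIP) coact_last_inr.
rewrite (tmap_comp (h := embed1)) //.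
rewrite -(tmap_comp (f := tmap embed1 (@idfun U)) (g := @iter_coact U D k2 _)) //.
congr tmap.
rewrite tmap_tmap_assoc /coact_last /=; congr tassoc.
elim/tensor_ind: (deltaI _) => [|u b t IH]; first by rewrite !linear0.
by rewrite !linearD /= IH !tmap_pure /= tmap_id.
Qed.
End Embedding.
End IteratedCoaction.

(** * The recursion defining [Gamma], lifted to the coideal *)

Section Chains.
Variables (F : fieldType) (s : F).
Local Notation U := (osp s).
Local Notation T := (tpow s).
Local Notation D := (@Delta F s).
Local Notation I := (coideal s).
Local Notation Cas := (Casimir s).

Variable deltaI : {lrmorphism I -> tensor U I}.
Hypothesis val_deltaI : forall x, val_last (deltaI x) = Delta (val x).
Hypothesis deltaIP : coassociative deltaI.
Variable tau : {lrmorphism I -> tensor U I}.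
Hypotheses (tauP : coassociative tau) (tau_Cas : tau (iCasimir s) = 1 ⊗ iCasimir s).

(* Elements of tensor powers whose exponents are only provably equal are compared
   as dependent pairs. *)
Definition tagI n (x : tensor (T n) I) := Tagged (fun n => tensor (T n) I : Type) x.
Definition tagT n (x : T n) := Tagged (fun n => T n : Type) x.

(* [stepI] and [chainI] are [step] and [chain] on elements whose last factor lies
   in the coideal; there they are algebra morphisms. *)
Definition stepI (b c : bool) m :
    tensor (T (~~ b + m)) I -> tensor (T (~~ c + m.+1)) I :=
  match b, c with
  | true, true => @coact_last F s I deltaI m
  | true, false => @coact_last F s I tau m.+1 \o @coact_last F s I deltaI m
  | false, false => tmap (@coact_last F s U D m) (@idfun I)
  | false, true => idfun
  end.

Lemma stepI_linear b c m : linear (@stepI b c m).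
Proof. by case: b c => [] []; [exact: linearP|exact: linearP|by []|exact: linearP]. Qed.

Lemma stepI_monoid b c m : monoid_morphism (@stepI b c m).
Proof. by case: b c => [] [] /=; split=> [|x y] //=; rewrite ?rmorph1 ?rmorphM. Qed.

Fixpoint chainI m (r : bitseq) :
    tensor (T m) I -> tensor (T (~~ head true r + (size r + m))) I :=
  match r with
  | [::] => idfun
  | c :: r' => @stepI (head true r') c (size r' + m) \o @chainI m r'
  end.

Lemma chainI_linear m r : linear (@chainI m r).
Proof. by elim: r => [|c r IH] //= a x y; rewrite /= IH stepI_linear. Qed.

Lemma chainI_monoid m r : monoid_morphism (@chainI m r).
Proof.
elim: r => [|c r [IH1 IHM]] //=.
have [S1 SM] := @stepI_monoid (head true r) c (size r + m).
by split=> [|x y] /=; rewrite ?IH1 // IHM SM.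
Qed.
HB.instance Definition _ m r := GRing.isLinear.Build F (tensor (T m) I)
  (tensor (T (~~ head true r + (size r + m))) I) _ (@chainI m r) (@chainI_linear m r).
HB.instance Definition _ m r := GRing.isMonoidMorphism.Build (tensor (T m) I)
  (tensor (T (~~ head true r + (size r + m))) I) (@chainI m r) (@chainI_monoid m r).

Lemma rpad_linear d m : linear (@rpad F s d m).
Proof. by elim: d => [|d IH] //= a x y; rewrite IH pure_linl. Qed.

Lemma rpad_monoid d m : monoid_morphism (@rpad F s d m).
Proof.
elim: d => [|d [IH1 IHM]] //; split=> [|x y] /=; first by rewrite IH1.
by rewrite IHM pureM mulr1.
Qed.
HB.instance Definition _ d m := GRing.isLinear.Build F (T m) (T (d + m)) _
  (@rpad F s d m) (@rpad_linear d m).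
HB.instance Definition _ d m := GRing.isMonoidMorphism.Build (T m) (T (d + m))
  (@rpad F s d m) (@rpad_monoid d m).

Lemma tagI_inj n (x y : tensor (T n) I) : tagI x = tagI y -> x = y.
Proof. exact: eq_from_Tagged. Qed.

Lemma tagI_step b b' c m m' (x : tensor (T (~~ b + m)) I) (x' : tensor (T (~~ b' + m')) I) :
  b = b' -> m = m' -> tagI x = tagI x' -> tagI (@stepI b c m x) = tagI (@stepI b' c m' x').
Proof. by move=> eb em; case: b' / eb x' => x'; case: m' / em x' => x' /tagI_inj ->. Qed.

Lemma tagI_iter_coact c k m m' (x : tensor (T m) I) (x' : tensor (T m') I) :
  tagI x = tagI x' -> tagI (iter_coact c k x) = tagI (iter_coact c k x').
Proof. by move=> e; exact: (congr1 (fun y => tagI (iter_coact c k (tagged y))) e). Qed.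

Lemma tagI_coact_last c m m' (x : tensor (T m) I) (x' : tensor (T m') I) :
  tagI x = tagI x' -> tagI (coact_last c x) = tagI (coact_last c x').
Proof. by move=> e; exact: (congr1 (fun y => tagI (coact_last c (tagged y))) e). Qed.

Lemma tagT_val m m' (x : tensor (T m) I) (x' : tensor (T m') I) :
  tagI x = tagI x' -> tagT (val_last x : T m.+1) = tagT (val_last x' : T m'.+1).
Proof. by move=> e; exact: (congr1 (fun y => @tagT (tag y).+1 (val_last (tagged y))) e).
  Qed.

Lemma tagT_rpad d m m' (x : T m) (x' : T m') :
  tagT x = tagT x' -> tagT (rpad d x) = tagT (rpad d x').
Proof. by move=> e; exact: (congr1 (fun y => tagT (rpad d (tagged y))) e). Qed.

Lemma rpadD d e m (x : T m) : tagT (rpad (d + e) x) = tagT (rpad d (rpad e x)).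
Proof.
elim: d => [|d IH] //=.
by exact: (congr1 (fun y => @tagT (tag y).+1 (tagged y ⊗ 1)) IH).
Qed.

Lemma chainI1 m r (y : T m) :
  tagI (chainI r (y ⊗ 1)) = tagI (rpad (~~ head true r + size r) y ⊗ 1).
Proof.
elim: r => [|c r IH] //=.
move: (chainI r (y ⊗ 1)) IH; case: (head true r) => /= z /tagI_inj ->.
  by case: c; rewrite /= !coact_last1.
case: c => //=.
by rewrite tmap_pure /= coact_last1.
Qed.

(** The condition on [r'] says that its last processed position lies in the set: no extra tensor
    factor is pending, so the recursion can be restarted there. *)
Lemma chainI_cat r r' m m' (x : tensor (T m) I) (y : tensor (T m') I) :
  head true r' = true -> m' = (size r' + m)%N -> tagI (chainI r' x) = tagI y ->
  tagI (chainI (r ++ r') x) = tagI (chainI r y).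
Proof.
move=> hr' em exy; elim: r => [|c r IH] //.
apply: (@tagI_step (head true (r ++ r')) (head true r) c (size (r ++ r') + m)%N (size r +
  m')%N) => //.
  by case: r {IH}.
by rewrite size_cat em addnA.
Qed.

Lemma chainI_nseq k m (x : tensor (T m) I) :
  tagI (chainI (nseq k true) x) = tagI (iter_coact deltaI k x).
Proof.
elim: k => [|k IH] //.
apply: (@tagI_step (head true (nseq k true)) true true
  (size (nseq k true) + m)%N (k + m)%N _ (iter_coact deltaI k x)) => //.
  by case: k {IH}.
by rewrite size_nseq.
Qed.

(** Only the first position of a gap applies [tau] literally; at the later ones [tmap_coact_last]
    converts the coproduct into another [tau]. *)
Lemma chainI_gap g k m (x : tensor (T m) I) :
  tagI (chainI (nseq g.+1 false ++ nseq k true) x)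
  = tagI (iter_coact tau g.+1 (coact_last deltaI (iter_coact deltaI k x))).
Proof.
elim: g => [|g IH].
  apply: (@tagI_step (head true (nseq k true)) true false
    (size (nseq k true) + m)%N (k + m)%N _ (iter_coact deltaI k x)).
  - by case: k.
  - by rewrite size_nseq.
  - exact: chainI_nseq.
have -> : iter_coact tau g.+2 (coact_last deltaI (iter_coact deltaI k x))
  = @stepI false false (g + (k + m).+1) (iter_coact tau g.+1 (coact_last deltaI
    (iter_coact deltaI k x))).
  by rewrite /= tmap_coact_last.
apply: (@tagI_step false false false (size (nseq g.+1 false ++ nseq k true) + m)%N
  (g + (k + m).+1)%N) => //.
by rewrite size_cat !size_nseq addnS -addnA addSn.
Qed.

(** Closing a gap is the identity step, the pending factor becoming the new position. For g = 0 the
    closing step is an ordinary coproduct, and the formula is the same. *)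
Lemma chainI_gap_start g k m (x : tensor (T m) I) :
  tagI (chainI (true :: nseq g false ++ nseq k true) x)
  = tagI (iter_coact tau g (coact_last deltaI (iter_coact deltaI k x))).
Proof.
case: g => [|g]; first exact: (chainI_nseq k.+1 x).
exact: chainI_gap.
Qed.

Lemma val_coact_last m (x : tensor (T m) I) :
  val_last (coact_last deltaI x) = coact_last D (m := m) (val_last x).
Proof.
pose f : {linear tensor (T m) I -> T m.+2} := @val_last F s (T m.+1) \o @coact_last F s I
  deltaI m.
pose g : {linear tensor (T m) I -> T m.+2} := @coact_last F s U D m \o @val_last F s (T m).
rewrite -[LHS]/(f x) -[RHS]/(g x); apply: tensor_linear_ext => a y.
rewrite /f /g /= coact_last_pure val_last_pure coact_last_pure /= -val_deltaI.
elim/tensor_ind: (deltaI y) => [|u b t IHt]; first by rewrite !(pure0r, linear0).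
by rewrite !(pureDr, linearD) /= IHt tassoc_pure !val_last_pure tassoc_pure.
Qed.

Lemma val_iter_coact k m (x : tensor (T m) I) :
  val_last (iter_coact deltaI k x) = iter_coact D k (m := m) (val_last x).
Proof. by elim: k => [|k IH] //=; rewrite val_coact_last IH. Qed.

(** On elements coming from the coideal the retraction undoes the inclusion, so its choice
    disappears. *)
Lemma tau_last_val m (x : tensor (T m) I) :
  tau_last tau (val_last x : T m.+1) = val_last (coact_last tau x).
Proof.
pose f : {linear tensor (T m) I -> T m.+2} := tassoc \o tmap idfun (tmap idfun \val)
  \o tmap idfun tau \o tmap idfun (subalg_proj (coideal_gen (s := s))) \o @val_last F s
    (T m).
pose g : {linear tensor (T m) I -> T m.+2} := @val_last F s (T m.+1) \o @coact_last F s I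
  tau m.
rewrite -[LHS]/(f x) -[RHS]/(g x); apply: tensor_linear_ext => a y.
rewrite /f /g /= val_last_pure tmap_pure /= subalg_projK !tmap_pure coact_last_pure /=.
elim/tensor_ind: (tau y) => [|u b t IHt]; first by rewrite !(pure0r, linear0).
by rewrite !(pureDr, linearD) /= IHt tmap_pure !tassoc_pure val_last_pure.
Qed.

(** Both branches are [val_last]; the exponents [~~ b + m.+1] and [(~~ b + m).+1] become convertible
    only once [b] is known. *)
Definition valb (b : bool) m : tensor (T (~~ b + m)) I -> T (~~ b + m.+1) :=
  match b with true => @val_last F s (T m) | false => @val_last F s (T m.+1) end.

Lemma step_valb b c m x : step tau c (valb (b := b) (m := m) x) = valb (stepI c x).
Proof.
case: b c x => [] [] x //=; first by rewrite val_coact_last.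
- refine (etrans _ (tau_last_val (m := m.+1) (coact_last deltaI (m := m) x))).
  exact: (f_equal (@tau_last F s tau m.+1) (esym (val_coact_last x))).
- elim/tensor_ind: x => [|a y x IH]; first by rewrite !linear0.
  by rewrite !linearD /= IH !(tmap_pure, val_last_pure).
Qed.

Lemma chain_valb a r :
  chain tau a r = valb (chainI r ((1 : T a) ⊗ iCasimir s)).
Proof.
elim: r => [|c r IH]; first by rewrite /= val_last_pure.
by rewrite /= IH step_valb.
Qed.

Lemma tagT_chain a r :
  tagT (chain tau a r) = tagT (val_last (chainI r ((1 : T a) ⊗ iCasimir s)) : T _.+1).
Proof. by rewrite chain_valb; move: (chainI _ _); case: (head true r). Qed.
End Chains.

(** * Subsets as words *)

Section Words.
Variables (F : fieldType) (s : F).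
Local Notation U := (osp s).
Local Notation T := (tpow s).
Local Notation D := (@Delta F s).
Local Notation I := (coideal s).
Local Notation Cas := (Casimir s).

Variable tau : {lrmorphism I -> tensor U I}.

Definition bitword n (X : {set 'I_n}) : bitseq := [seq i \in X | i <- enum 'I_n].

Lemma size_bitword n (X : {set 'I_n}) : size (bitword X) = n.
Proof. by rewrite size_map size_enum_ord. Qed.

Lemma nth_bitword n (X : {set 'I_n}) (i : 'I_n) : nth false (bitword X) i = (i \in X).
Proof. by rewrite (nth_map i) ?size_enum_ord // nth_ord_enum. Qed.

Lemma smin_eq n (X : {set 'I_n}) (i : 'I_n) :
  i \in X -> {in X, forall j : 'I_n, i <= j}%N -> smin X = i.
Proof.
move=> iX imin; apply/eqP; rewrite eqn_leq; apply/andP; split.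
  have := mem_index_enum i; rewrite /smin.
  elim: (index_enum _) => [|j t IH] //; rewrite inE big_cons => /orP[/eqP <-|/IH le_i].
    by rewrite iX geq_minl.
  by case: ifP => // _; rewrite geq_min le_i orbT.
rewrite /smin; elim/big_ind: _ => [|x y lex ley|j jX]; first exact: ltnW.
  by rewrite leq_min lex.
exact: imin.
Qed.

Lemma smax_eq n (X : {set 'I_n}) (i : 'I_n) :
  i \in X -> {in X, forall j : 'I_n, j <= i}%N -> smax X = i.
Proof.
move=> iX imax; apply/eqP; rewrite eqn_leq; apply/andP; split.
  by apply/bigmax_leqP.
by rewrite /smax (bigD1 i) //= leq_maxl.
Qed.

Lemma tagT_tcast m n (x : T m) : m = n -> tagT (Defs.tcast n x) = tagT x.
Proof. by rewrite /Defs.tcast; case: eqP => // e _; case: n / e. Qed.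

Lemma filter_iota_between a l d :
  [seq k <- iota 0 (a.+1 + (l + d)) | (a < k <= a + l)%N] = iota a.+1 l.
Proof.
rewrite iotaD filter_cat add0n iotaD filter_cat.
rewrite (eq_in_filter (a2 := pred0)) => [|k]; last first.
  by rewrite mem_iota add0n ltnS /= => le_ka; rewrite ltnNge le_ka.
rewrite filter_pred0 cat0s (eq_in_filter (a2 := predT)) => [|k]; last first.
  by rewrite mem_iota addSn ltnS.
rewrite filter_predT (eq_in_filter (a2 := pred0)) => [|k]; last first.
  by rewrite mem_iota addSn => /andP[lek _]; apply/negP => /andP[_]; rewrite leqNgt lek.
by rewrite filter_pred0 cats0.
Qed.

(** Here [a] is the minimum and [a + size r] the maximum of [X]. The condition [head true r] puts
    the maximum in [X], the default [true] covering singletons. *)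
Lemma Gamma_word n (X : {set 'I_n}) a r d :
  bitword X = nseq a false ++ true :: rev r ++ nseq d false -> head true r ->
  tagT (Gamma tau X) = tagT (rpad d (chain tau a r)).
Proof.
move=> wX hr; have nE : n = (a.+1 + (size r + d))%N.
  by rewrite -(size_bitword X) wX size_cat /= size_cat size_rev !size_nseq addnS.
have lt_an : (a < n)%N by rewrite nE leq_addr.
have lt_cn : (a + size r < n)%N by rewrite nE addSn ltnS leq_add2l leq_addr.
have Xa : Ordinal lt_an \in X.
  by rewrite -nth_bitword wX nth_cat size_nseq /= ltnn subnn.
have Xc : Ordinal lt_cn \in X.
  rewrite -nth_bitword wX nth_cat size_nseq /= ltnNge leq_addr addKn.
  case: r hr {wX nE lt_cn} => [|c r] //= ->.
  by rewrite rev_cons nth_cat size_rcons size_rev ltnSn nth_rcons size_rev ltnn eqxx.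
have minX : smin X = a.
  apply: (smin_eq Xa) => j; rewrite -nth_bitword wX nth_cat size_nseq /=.
  by case: ltnP => //; rewrite nth_nseq => ->.
have maxX : smax X = (a + size r)%N.
  apply: (smax_eq Xc) => j; rewrite -nth_bitword wX -cat_cons catA nth_cat.
  rewrite size_cat size_nseq /= size_rev addnS ltnS.
  by case: leqP => // _; rewrite nth_nseq if_same.
have filt : [seq i \in X | i : 'I_n <- enum 'I_n & (a < i <= a + size r)%N] = rev r.
  transitivity [seq nth false (bitword X) k | k <- iota a.+1 (size r)].
    rewrite -(filter_iota_between a _ d) -nE -val_enum_ord filter_map -map_comp.
    by apply: eq_map => i; rewrite /= nth_bitword.
  rewrite map_nth_iota; last by rewrite size_bitword nE addKn leq_addr.
  rewrite wX -cat_rcons drop_size_cat ?size_rcons ?size_nseq //.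
  by rewrite take_size_cat ?size_rev.
have X0 : X == finset.set0 = false by apply/negP => /eqP X0; rewrite X0 inE in Xa.
have dE : (n - (a + size r).+1)%N = d by rewrite nE -addSn addnA addKn.
rewrite /Gamma X0 minX maxX filt revK dE tagT_tcast //.
by rewrite hr /= nE addnC addnA addSn (addnC a).
Qed.

Lemma Gamma_eq n (X : {set 'I_n}) (x : T n) : tagT (Gamma tau X) = tagT x -> Gamma tau X
  = x.
Proof. exact: eq_from_Tagged. Qed.

Lemma map_iota_const (f : nat -> bool) c m l :
  (forall k, (m <= k < m + l)%N -> f k = c) -> [seq f k | k <- iota m l] = nseq l c.
Proof.
move=> fc; have /eq_in_map -> : {in iota m l, f =1 fun=> c}.
  by move=> k; rewrite mem_iota; exact: fc.
by elim: l m {fc} => //= l IH m; rewrite IH.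
Qed.

End Words.

(** * The algebra morphism attached to the three zones *)

Section Realization.
Variables (F : fieldType) (s : F).
Local Notation U := (osp s).
Local Notation T := (tpow s).
Local Notation D := (@Delta F s).
Local Notation I := (coideal s).
Local Notation Cas := (Casimir s).

Variable deltaI : {lrmorphism I -> tensor U I}.
Hypothesis val_deltaI : forall x, val_last (deltaI x) = Delta (val x).
Hypothesis deltaIP : coassociative deltaI.
Variable tau : {lrmorphism I -> tensor U I}.
Hypotheses (tauP : coassociative tau) (tau_Cas : tau (iCasimir s) = 1 ⊗ iCasimir s).
Local Notation iCas := (iCasimir s).

Variables (i k1 k2 g d : nat) (r : bitseq).
Hypothesis r_last : head true r.
Local Notation M := (k2 + (k1 + i).+1).+1.

(** A1 starts at i with k1 + 1 positions, A2 has the next k2 + 1, a gap of g follows, and A3 starts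
    at g + M. The reversed word [r] describes A3 after its minimum, and d positions trail. *)
Definition realize : tensor (tensor U U) I ->
    T (d + (~~ head true r + (size r + (g + M))).+1) :=
  (@rpad F s d (~~ head true r + (size r + (g + M))).+1 \o
    @val_last F s (T (~~ head true r + (size r + (g + M)))))
  \o @chainI F s deltaI tau (g + M) r \o embed3 tau i k1 k2 g.
HB.instance Definition _ := GRing.Linear.on realize.
HB.instance Definition _ := GRing.RMorphism.on realize.

(** The word [r'] leads up to the minimum of A3; the continuation along [r] is common to all
    elements involving A3. *)
Lemma realize_chain a r' y : head true r' = true -> (g + M = size r' + a)%N ->
  tagI (chainI deltaI tau r' ((1 : T a) ⊗ iCas)) = tagI (embed3 tau i k1 k2 g y) ->
  tagT (rpad d (chain tau a (r ++ r'))) = tagT (realize y).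
Proof.
move=> hr' aE ry; apply: tagT_rpad; rewrite (tagT_chain val_deltaI).
apply: tagT_val; exact: chainI_cat.
Qed.

(** A trivial coideal leg produces only factors 1: one for each bit of [r], one for the minimum of
    A3, and the d trailing ones. *)
Lemma realize_rpad (z : T (g + M)) y : embed3 tau i k1 k2 g y = z ⊗ 1 ->
  tagT (realize y) = tagT (rpad (d + (size r).+1) z).
Proof.
move=> yz; rewrite rpadD; apply: tagT_rpad; rewrite /= yz.
have /tagT_val -> := chainI1 deltaI tau r z.
by rewrite val_last_pure r_last.
Qed.

Lemma tagT_chain_nseq k a :
  tagT (chain tau a (nseq k true)) = tagT (iter_coact D k ((1 : T a) ⊗ Cas) : T (k + a).+1).
Proof.
rewrite (tagT_chain val_deltaI); have /tagT_val -> := chainI_nseq deltaI tau k ((1 : T a)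
  ⊗ iCas).
by rewrite (val_iter_coact val_deltaI) val_last_pure.
Qed.

Lemma realize_gamma1 e : e = (d + (size r).+1 + g + k2.+1)%N ->
  tagT (realize (gamma1 s)) = tagT (rpad e (chain tau i (nseq k1 true))).
Proof.
move=> ->; rewrite (realize_rpad (embed_gamma1 _ _ _ _ _)) -rpadD.
refine (etrans (esym (rpadD (d + (size r).+1 + g) k2.+1 _)) _).
by apply: tagT_rpad; rewrite tagT_chain_nseq.
Qed.

Lemma realize_gamma2 e : e = (d + (size r).+1 + g)%N ->
  tagT (realize (gamma2 s)) = tagT (rpad e (chain tau (k1 + i).+1 (nseq k2 true))).
Proof.
move=> ->; rewrite (realize_rpad (embed_gamma2 _ _ _ _ _)) -rpadD.
by apply: tagT_rpad; rewrite tagT_chain_nseq.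
Qed.

Lemma realize_gamma12 e : e = (d + (size r).+1 + g)%N ->
  tagT (realize (gamma12 s)) = tagT (rpad e (chain tau i (nseq (k2 + k1.+1) true))).
Proof.
move=> ->; rewrite (realize_rpad (embed_gamma12 _ _ _ _ _)) -rpadD.
apply: tagT_rpad; rewrite tagT_chain_nseq.
exact: (congr1 (fun y : {n & tensor (T n) U : Type} => @tagT F s (tag y).+1 (tagged y))
  (esym (iter_coactD D k2 k1.+1 ((1 : T i) ⊗ Cas)))).
Qed.

Lemma realize_gamma3 : tagT (realize (gamma3 s)) = tagT (rpad d (chain tau (g + M) r)).
Proof.
rewrite -[in RHS](cats0 r); apply/esym/realize_chain => //.
by rewrite embed_gamma3.
Qed.

Lemma realize_gamma123 : tagT (realize (gamma123 deltaI)) =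
  tagT (rpad d (chain tau i (r ++ true :: nseq g false ++ nseq (k2 + k1.+1) true))).
Proof.
apply/esym/realize_chain => //; first by rewrite /= size_cat !size_nseq; lia.
rewrite embed_gamma123 // chainI_gap_start //; apply/tagI_iter_coact/tagI_coact_last.
exact: iter_coactD.
Qed.

Lemma realize_gamma23 : tagT (realize (gamma23 deltaI)) =
  tagT (rpad d (chain tau (k1 + i).+1 (r ++ true :: nseq g false ++ nseq k2 true))).
Proof.
apply/esym/realize_chain => //; first by rewrite /= size_cat !size_nseq; lia.
by rewrite embed_gamma23 // chainI_gap_start.
Qed.

Lemma realize_gamma13 : tagT (realize (gamma13 deltaI tau)) =
  tagT (rpad d (chain tau i (r ++ true :: nseq (g + k2.+1) false ++ nseq k1 true))).
Proof.
apply/esym/realize_chain => //; first by rewrite /= size_cat !size_nseq; lia.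
rewrite embed_gamma13 // chainI_gap_start //; exact: iter_coactD.
Qed.
End Realization.

Lemma bitword_iota n (X : {set 'I_n}) (f : nat -> bool) :
  (forall j : 'I_n, (j \in X) = f j) -> bitword X = [seq f k | k <- iota 0 n].
Proof. by move=> Xf; rewrite -val_enum_ord -map_comp; apply: eq_map => j; exact: Xf. Qed.

(** * Words of the unions of A \ B, A ∩ B and B \ A *)

Section Zones.
Variables (i k1 k2 g l d n : nat).
Local Notation b := (i + k1.+1 + k2.+1 + g)%N.
Hypothesis nE : n = (b + l.+1 + d)%N.
Variables A1 A2 A3 : {set 'I_n}.
Hypothesis A1P : forall j : 'I_n, (j \in A1) = (i <= j < i + k1.+1)%N.
Hypothesis A2P : forall j : 'I_n, (j \in A2) = (i + k1.+1 <= j < i + k1.+1 + k2.+1)%N.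
Let in3 (k : nat) := k \in [seq val j | j in A3].
Hypothesis A3P : forall j : 'I_n, j \in A3 -> (b <= j <= b + l)%N.
Hypotheses (A3b : in3 b) (A3l : in3 (b + l)).

Definition bits3 : bitseq := [seq in3 k | k <- iota b.+1 l].

Definition pattern (x1 x2 x3 : bool) (X : {set 'I_n}) :=
  forall j, (j \in X) = [|| x1 && (j \in A1), x2 && (j \in A2) | x3 && (j \in A3)].

Lemma bitword_pattern x1 x2 x3 X : pattern x1 x2 x3 X ->
  bitword X = nseq i false ++ nseq k1.+1 x1 ++ nseq k2.+1 x2 ++ nseq g false ++
    (if x3 then true :: bits3 else nseq l.+1 false) ++ nseq d false.
Proof.
move=> XP; have in3P k : in3 k -> (b <= k <= b + l)%N.
  by case/imageP => j jA ->; exact: A3P.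
rewrite (@bitword_iota _ _ (fun k => [|| x1 && (i <= k < i + k1.+1)%N,
  x2 && (i + k1.+1 <= k < i + k1.+1 + k2.+1)%N | x3 && in3 k])) => [|j]; last first.
  rewrite XP A1P A2P; congr [|| _, _ | _ && _]; apply/idP/imageP => [jA|[j' jA /val_inj
    -> //]].
  by exists j.
set f := (X in map X _).
have -> : n = (i + (k1.+1 + (k2.+1 + (g + (l.+1 + d)))))%N by rewrite nE !addnA.
have out3 k : (k < b)%N || (b + l < k)%N -> in3 k = false.
  by move=> kb; apply/negP => /in3P /andP[]; case/orP: kb; lia.
rewrite !iotaD !map_cat !add0n.
congr (_ ++ (_ ++ (_ ++ (_ ++ (_ ++ _))))).
- apply: map_iota_const => k /andP[_ kb]; rewrite /f out3 ?andbF ?orbF; lia.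
- apply: map_iota_const => k /andP[kb kb']; rewrite /f out3 ?andbF ?orbF; lia.
- apply: map_iota_const => k /andP[kb kb']; rewrite /f out3 ?andbF ?orbF; lia.
- apply: map_iota_const => k /andP[kb kb']; rewrite /f out3 ?andbF ?orbF; lia.
- case: ifP => x3E; last first.
    apply: map_iota_const => k /andP[kb kb']; rewrite /f x3E /= orbF; lia.
  rewrite -[true :: _]/(true :: bits3) -A3b -[RHS]/[seq in3 k | k <- iota b l.+1].
  apply/eq_in_map => k; rewrite mem_iota => /andP[kb kb'].
  rewrite /f x3E; have -> : (k < i + k1.+1)%N = false by lia.
  have -> : (k < i + k1.+1 + k2.+1)%N = false by lia.
  by rewrite !andbF.
- apply: map_iota_const => k /andP[kb kb']; rewrite /f out3 ?andbF ?orbF; lia.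
Qed.

Lemma bits3_last : head true (rev bits3).
Proof.
rewrite /bits3; case: (l) A3l => [|l'] // A3l'.
by rewrite -[l'.+1]addn1 iotaD map_cat rev_cat /= addSn -addnS.
Qed.

Lemma size_bits3 : size bits3 = l.
Proof. by rewrite size_map size_iota. Qed.

Variables (F : fieldType) (s : F).
Local Notation U := (osp s).
Local Notation T := (tpow s).
Local Notation I := (coideal s).
Variable deltaI : {lrmorphism I -> tensor U I}.
Hypothesis val_deltaI : forall x, val_last (deltaI x) = Delta (val x).
Hypothesis deltaIP : coassociative deltaI.
Variable tau : {lrmorphism I -> tensor U I}.
Hypotheses (tauP : coassociative tau) (tau_Cas : tau (iCasimir s) = 1 ⊗ iCasimir s).

(** The value at three [false] is a placeholder, excluded in [Gamma_pattern]. *)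
Definition gamma_of (x1 x2 x3 : bool) : tensor (tensor U U) I :=
  match x1, x2, x3 with
  | true, true, false => gamma12 s
  | false, true, true => gamma23 deltaI
  | true, false, true => gamma13 deltaI tau
  | true, true, true => gamma123 deltaI
  | true, false, false => gamma1 s
  | false, true, false => gamma2 s
  | false, false, _ => gamma3 s
  end.

Lemma Gamma_pattern x1 x2 x3 X : [|| x1, x2 | x3] -> pattern x1 x2 x3 X ->
  tagT (Gamma tau X) = tagT (realize deltaI tau i k1 k2 g d (rev bits3) (gamma_of x1 x2
    x3)).
Proof.
move=> x123 /bitword_pattern; have b3 := bits3_last.
have sz : size (rev bits3) = l by rewrite size_rev size_bits3.
have b3' t : head true t -> head true (rev bits3 ++ t) by case: (rev bits3) b3.
have h1 k : head true (nseq k true) by case: k.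
have T12 : nseq k1.+1 true ++ nseq k2.+1 true = true :: nseq (k2 + k1.+1) true.
  by rewrite -nseqD addnC.
have iE : (k1 + i).+1 = (i + k1.+1)%N by rewrite addnS addnC.
case: x1 x2 x3 x123 => [] [] [] // _ wX; rewrite [gamma_of _ _ _]/=.
- rewrite realize_gamma123 //; apply: Gamma_word; last exact: b3'.
  rewrite wX rev_cat revK rev_cons rev_cat !rev_nseq cat_rcons.
  by rewrite -!catA [nseq k1.+1 _ ++ _]catA T12.
- rewrite (realize_gamma12 val_deltaI tau i k1 k2 b3 (e := (g + (l.+1 + d))%N)) //; last
  by rewrite sz; lia.
  apply: Gamma_word; last exact: h1.
  by rewrite wX rev_nseq (nseqD g) (nseqD l.+1) [nseq k1.+1 _ ++ _]catA T12.
- rewrite realize_gamma13 //; apply: Gamma_word; last exact: b3'.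
  rewrite wX rev_cat revK rev_cons rev_cat !rev_nseq cat_rcons.
  by rewrite -!catA addnC nseqD -!catA.
- rewrite (realize_gamma1 val_deltaI tau i k1 b3 (e := (k2.+1 + (g + (l.+1 + d)))%N)) //;
  last by rewrite sz; lia.
  apply: Gamma_word; last exact: h1.
  by rewrite wX rev_nseq !nseqD.
- rewrite realize_gamma23 //; apply: Gamma_word; last exact: b3'.
  rewrite wX rev_cat revK rev_cons rev_cat !rev_nseq cat_rcons.
  by rewrite iE nseqD -!catA.
- rewrite (realize_gamma2 val_deltaI tau i k1 k2 b3 (e := (g + (l.+1 + d))%N)) //; last
  by rewrite sz; lia.
  apply: Gamma_word; last exact: h1.
  by rewrite wX rev_nseq iE !nseqD -!catA.
- rewrite realize_gamma3 //; apply: Gamma_word => //.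
  rewrite wX revK; have -> : (g + (k2 + (k1 + i).+1).+1 = i + (k1.+1 + (k2.+1 + g)))%N by
    lia.
  by rewrite !nseqD -!catA.
Qed.
End Zones.

Lemma lrmorphism_cast (F : fieldType) (s : F) (V : algType F) m n
    (f : {lrmorphism V -> tpow s m}) : m = n ->
  exists f' : {lrmorphism V -> tpow s n}, forall x, tagT (f' x) = tagT (f x).
Proof. by case: n /; exists f. Qed.

Lemma ex_min_max n (X : {set 'I_n}) : X != finset.set0 ->
  exists a b : 'I_n, [/\ a \in X, b \in X & {in X, forall j : 'I_n, a <= j <= b}%N].
Proof.
case/set0Pn => x xX.
have [a aX amin] := arg_minnP (fun j : 'I_n => j : nat) xX.
have [b bX bmax] := arg_maxnP (fun j : 'I_n => j : nat) xX.
by exists a, b; split=> // j jX; apply/andP; split; [exact: amin|exact: bmax].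
Qed.

(** With A = [i; j] and a2 the least element of A ∩ B, the ordering of the zones forces A \ B =
    [i; a2 - 1] and A ∩ B = [a2; j], while B \ A lies beyond j. *)
Lemma zones_of_matches n (A B : {set 'I_n}) : matches A B -> consecutive A ->
  exists i k1 k2 g l d : nat, let b := (i + k1.+1 + k2.+1 + g)%N in
  [/\ n = (b + l.+1 + d)%N,
      forall j : 'I_n, (j \in A :\: (A :&: B)) = (i <= j < i + k1.+1)%N,
      forall j : 'I_n, (j \in A :&: B) = (i + k1.+1 <= j < i + k1.+1 + k2.+1)%N,
      forall j : 'I_n, j \in B :\: (A :&: B) -> (b <= j <= b + l)%N
    & b \in [seq val j | j in B :\: (A :&: B)]
      /\ (b + l)%N \in [seq val j | j in B :\: (A :&: B)]].
Proof.
case=> /ex_min_max[a1 [b1 [a1A b1A P1]]] /ex_min_max[a2 [b2 [a2A b2A P2]]].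
case/ex_min_max=> a3 [b3 [a3A b3A P3]].
rewrite (smax_eq b1A) => [|j /P1/andP[]//]; rewrite (smin_eq a2A) => [|j /P2/andP[]//].
rewrite (smax_eq b2A) => [|j /P2/andP[]//]; rewrite (smin_eq a3A) => [|j /P3/andP[]//].
move=> b1a2 b2a3 [i [j AE]].
have inA k : (k \in A) = (i <= k <= j)%N by rewrite AE inE.
have A12 k : (k \in A) = (k \in A :\: (A :&: B)) || (k \in A :&: B).
  by rewrite !inE; case: (k \in A); case: (k \in B).
have A1A k : k \in A :\: (A :&: B) -> k \in A by rewrite A12 => ->.
have A2A k : k \in A :&: B -> k \in A by rewrite A12 orbC => ->.
have /andP[_ ab1] := P1 _ a1A; have /andP[_ ab2] := P2 _ a2A; have /andP[_ ab3] := P3 _ a3A.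
have := A1A _ a1A; have := A2A _ b2A; rewrite !inA => /andP[_ b2j] /andP[ia1 _].
have ia2 : (i < a2)%N by apply: leq_ltn_trans b1a2; exact: leq_trans ab1.
have a2j : (a2 <= j)%N by exact: leq_trans b2j.
have ij : (i <= j)%N by exact: leq_trans (ltnW ia2) a2j.
have i1 : i \in A :\: (A :&: B).
  have : i \in A by rewrite inA leqnn.
  by rewrite A12 => /orP[//|/P2/andP[]]; rewrite leqNgt ia2.
have j2 : j \in A :&: B.
  have : j \in A by rewrite inA leqnn ij.
  by rewrite A12 => /orP[/P1/andP[_]|//]; rewrite leqNgt (leq_trans b1a2).
have ja3 : (j < a3)%N by apply: leq_ltn_trans b2a3; have /andP[] := P2 _ j2.
(* The parameters k1, k2 and l are zone lengths minus one, all three zones being nonempty; the gap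
   runs from j + 1 to a3 - 1. *)
exists i, (a2 - i).-1, (j - a2)%N, (a3 - j.+1)%N, (b3 - a3)%N, (n - b3.+1)%N => /=.
have E1 : (i + (a2 - i).-1.+1)%N = a2 by rewrite prednK ?subn_gt0 // subnKC // ltnW.
have E2 : (a2 + (j - a2).+1)%N = j.+1 by rewrite addnS subnKC.
have E3 : (j.+1 + (a3 - j.+1))%N = a3 by rewrite subnKC.
have E4 : (a3 + (b3 - a3))%N = b3 by rewrite subnKC.
rewrite E1 E2 E3 E4; split=> [|k|k|k /P3 //|].
- by rewrite addnS E4 subnKC.
- apply/idP/andP => [k1|[ik ka2]].
    have /andP[_ kb1] := P1 _ k1; have := A1A _ k1; rewrite inA => /andP[ik _].
    by rewrite ik (leq_ltn_trans kb1).
  have : k \in A by rewrite inA ik (leq_trans (ltnW ka2)).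
  by rewrite A12 => /orP[//|/P2/andP[]]; rewrite leqNgt ka2.
- rewrite ltnS; apply/idP/andP => [k2|[ak kj]].
    by have /andP[] := P2 _ k2; have := A2A _ k2; rewrite inA => /andP[].
  have : k \in A by rewrite inA kj (leq_trans (ltnW ia2)).
  rewrite A12 => /orP[/P1/andP[_ kb1]|//].
  by have := leq_ltn_trans (leq_trans ak kb1) b1a2; rewrite ltnn.
- by split; apply/imageP; [exists a3|exists b3].
Qed.

(** The values of [g] are images under one algebra morphism, which transports the three relations.
    Indexing by membership patterns lets differently written but equal sets be identified by truth
    tables. *)
Lemma bannai_ito (F : fieldType) (s : F) (s0 : s != 0) (sp0 : s + s^-1 != 0)
    (sm0 : s - s^-1 != 0) (tau : {lrmorphism coideal s -> tensor (osp s) (coideal s)})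
    (tauP : is_coaction tau) n (A B : {set 'I_n}) :
  matches A B -> consecutive A ->
  let A1 := A :\: (A :&: B) in let A2 := A :&: B in let A3 := B :\: (A :&: B) in
  exists (g : bool -> bool -> bool -> tpow s n),
  [/\ forall x1 x2 x3 X, [|| x1, x2 | x3] -> pattern A1 A2 A3 x1 x2 x3 X ->
        Gamma tau X = g x1 x2 x3,
      qanticomm s (g true true false) (g false true true) = g true false true
        + (s + s^-1) *: (g false true false * g true true true
                         + g true false false * g false false true),
      qanticomm s (g false true true) (g true false true) = g true true false
        + (s + s^-1) *: (g false false true * g true true true
                         + g false true false * g true false false)
    & qanticomm s (g true false true) (g true true false) = g false true true
        + (s + s^-1) *: (g true false false * g true true true
                         + g false false true * g false true false)].
Proof.
move=> AB Acons A1 A2 A3.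
have [deltaI val_deltaI] := coideal_Delta_exists sm0.
have [i [k1 [k2 [g [l [d [nE P1 P2 P3 [P3b P3l]]]]]]]] := zones_of_matches AB Acons.
have deltaIP := deltaI_coassoc val_deltaI.
have tauC := tau_coassoc s0 tauP.
have tauG : tau (iCasimir s) = 1 ⊗ iCasimir s by have [] := tauP.
have Gpat := Gamma_pattern nE P1 P2 P3 P3b P3l val_deltaI deltaIP tauC tauG.
set r := rev _ in Gpat.
have [|f fE] := lrmorphism_cast (n := n) (realize deltaI tau i k1 k2 g d r).
  rewrite nE /r (bits3_last P3l) size_rev size_bits3. lia.
have f_qa x y : f (qanticomm s x y) = qanticomm s (f x) (f y).
  by rewrite /qanticomm linearD !linearZ /= !rmorphM.
exists (fun x1 x2 x3 => f (gamma_of deltaI tau x1 x2 x3)); split=> /=.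
- by move=> x1 x2 x3 X x123 /(Gpat _ _ _ _ x123) XE; apply: Gamma_eq; rewrite fE.
- by rewrite -f_qa (gamma_rel1 s0 sp0 sm0 val_deltaI tauP) linearD linearZ linearD /=
  !rmorphM.
- by rewrite -f_qa (gamma_rel2 s0 sp0 sm0 val_deltaI tauP) linearD linearZ linearD /=
  !rmorphM.
- by rewrite -f_qa (gamma_rel3 s0 sp0 sm0 val_deltaI tauP) linearD linearZ linearD /=
  !rmorphM.
Qed.

Theorem theorem1 (R : realType) (q s : R[i])
    (q_neq0 : q != 0) (q_norm : `|q| != 1) (s_sqrt : s ^+ 2 = q)
    (tau : {lrmorphism coideal s -> tensor (osp s) (coideal s)})
    (tau_coaction : is_coaction tau)
    (n : nat) (n_ge3 : (3 <= n)%N) (A B : {set 'I_n})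
    (AB_matches : matches A B) (A_interval : consecutive A) :
  let C := (A :|: B) :\: (A :&: B) in
  let G := Gamma tau (n := n) in
  [/\ qanticomm s (G A) (G B) =
        G C + (s + s^-1) *: (G (A :&: B) * G (A :|: B)
                             + G (A :\: (A :&: B)) * G (B :\: (A :&: B))),
      qanticomm s (G B) (G C) =
        G A + (s + s^-1) *: (G (B :&: C) * G (B :|: C)
                             + G (B :\: (B :&: C)) * G (C :\: (B :&: C)))
    & qanticomm s (G C) (G A) =
        G B + (s + s^-1) *: (G (C :&: A) * G (C :|: A)
                             + G (C :\: (C :&: A)) * G (A :\: (C :&: A)))].
Proof.
move=> C G; have s0 : s != 0 by move: q_neq0; rewrite -s_sqrt expf_eq0.
(* Otherwise s = -s^-1, so q = s^2 = -1 has norm 1. *)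
have sp0 : s + s^-1 != 0.
  apply: contraNneq q_norm => /eqP; rewrite addr_eq0 => /eqP sE.
  by rewrite -s_sqrt expr2 {2}sE mulrN mulfV // normrN1.
(* Otherwise s = s^-1, so q = 1. *)
have sm0 : s - s^-1 != 0.
  apply: contraNneq q_norm => /eqP; rewrite subr_eq0 => /eqP sE.
  by rewrite -s_sqrt expr2 {2}sE mulfV // normr1.
have [g [gE rel1 rel2 rel3]] := bannai_ito s0 sp0 sm0 tau_coaction AB_matches A_interval.
(* Every set in the statement is a union of the three zones, hence determined by three bits. *)
have gX x1 x2 x3 (X : {set 'I_n}) : [|| x1, x2 | x3] ->
    (forall j, (j \in X) = [|| x1 && ((j \in A) && (j \notin B)),
      x2 && ((j \in A) && (j \in B)) | x3 && ((j \in B) && (j \notin A))]) ->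
    G X = g x1 x2 x3.
  move=> x123 XP; apply: gE => // j; rewrite XP !inE.
  by case: (j \in A); case: (j \in B).
have GA : G A = g true true false.
  by apply: gX => // j; case: (j \in A); case: (j \in B).
have GB : G B = g false true true.
  by apply: gX => // j; case: (j \in A); case: (j \in B).
have GC : G C = g true false true.
  by apply: gX => // j; rewrite !inE; case: (j \in A); case: (j \in B).
have G123 (X : {set 'I_n}) : X = A :|: B -> G X = g true true true.
  by move=> ->; apply: gX => // j; rewrite !inE; case: (j \in A); case: (j \in B).
have G1 (X : {set 'I_n}) : X = A :\: B -> G X = g true false false.
  by move=> ->; apply: gX => // j; rewrite !inE; case: (j \in A); case: (j \in B).
have G2 (X : {set 'I_n}) : X = A :&: B -> G X = g false true false.
  by move=> ->; apply: gX => // j; rewrite !inE; case: (j \in A); case: (j \in B).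
have G3 (X : {set 'I_n}) : X = B :\: A -> G X = g false false true.
  by move=> ->; apply: gX => // j; rewrite !inE; case: (j \in A); case: (j \in B).
rewrite GA GB GC; split.
- rewrite rel1 (G2 (A :&: B)) // (G123 (A :|: B)) // (G1 (A :\: _)) ?(G3 (B :\: _)) //;
  by apply/setP => j; rewrite !inE; case: (j \in A); case: (j \in B).
- rewrite rel2 (G3 (B :&: C)) ?(G123 (B :|: C)) ?(G2 (B :\: _)) ?(G1 (C :\: _)) //;
  by apply/setP => j; rewrite !inE; case: (j \in A); case: (j \in B).
- rewrite rel3 (G1 (C :&: A)) ?(G123 (C :|: A)) ?(G3 (C :\: _)) ?(G2 (A :\: _)) //;
  by apply/setP => j; rewrite !inE; case: (j \in A); case: (j \in B).
Qed.
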